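(* Let $X \subset \mathbb{P}^N$ be a projective variety over $\mathbb{C}$, and let $X^* \subset (\mathbb{P}^N)^*$ be its projective dual. For an integer $r$, denote by $\tilde{X}^*_r$ the variety $$\tilde{X}^*_r := \{ H^{\perp} \in X^* \ \text{such that}\ \dim \langle (H \cap X)^{red}_{tan} \rangle \geq r \}.$$ Then $\dim \tilde{X}^*_r \leq N-r-1$.
   Context: For a hyperplane $H \subset \mathbb{P}^N$, $H^{\perp}$ denotes the corresponding point of the dual projective space $(\mathbb{P}^N)^*$. The conormal variety $I_X \subset \mathbb{P}^N \times (\mathbb{P}^N)^*$ is the Zariski closure of the set of pairs $(x,H^{\perp})$ with $x$ a smooth point of $X$ and $H$ a hyperplane containing the embedded projective tangent space to $X$ at $x$. The projective dual $X^*$ is the image of $I_X$ in $(\mathbb{P}^N)^*$. For $H^{\perp}\in X^*$, the tangency scheme $(H\cap X)_{tan} \subset X$ of $H$ along $X$ is the scheme-theoretic fibre of $I_X \to X^*$ over $H^{\perp}$, viewed as a subscheme of $X\subset \mathbb{P}^N$, and $(H \cap X)^{red}_{tan}$ is its underlying reduced scheme (the reduced tangency locus). $\langle \cdot \rangle$ denotes the linear span in $\mathbb{P}^N$, and $\dim$ of a linear span is its projective dimension. *)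

(* Defs.v *)
From mathcomp Require Import all_boot all_order all_algebra.
From mathcomp Require Import complex mpoly.
From mathcomp Require Import classical_sets reals.

Set Implicit Arguments.
Unset Strict Implicit.
Unset Printing Implicit Defensive.

Import GRing.Theory.

Local Open Scope ring_scope.
Local Open Scope classical_set_scope.

(* Topological notions, for the topology whose family of closed sets is
   [closed].  Subsets carry the induced topology. *)
Section Topology.
Variables (T : Type) (closed : set (set T)).

Definition top_closure (S : set T) : set T :=
  [set x | forall C, closed C -> S `<=` C -> C x].

Definition closed_in (S Z : set T) : Prop :=
  exists2 C, closed C & Z = S `&` C.

Definition irreducible (Z : set T) : Prop :=
  Z !=set0 /\
  forall A B, closed A -> closed B -> Z `<=` A `|` B -> Z `<=` A \/ Z `<=` B.

Definition irred_chain (S : set T) (n : nat) (Z : nat -> set T) : Prop :=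
  (forall i, (i <= n)%N -> closed_in S (Z i) /\ irreducible (Z i)) /\
  (forall i, (i < n)%N -> Z i `<` Z i.+1).

(* Krull dimension.  The bound is an integer, and the empty set, which has no
   chain at all, has dimension -oo. *)
Definition dim_le (S : set T) (m : int) : Prop :=
  forall n Z, irred_chain S n Z -> n%:Z <= m.

Definition dim_eq (S : set T) (d : nat) : Prop :=
  (exists Z, irred_chain S d Z) /\ dim_le S d%:Z.

End Topology.

Section ProjectiveGeometry.
Variables (K : fieldType) (N : nat).

(* A point of P^N is a line through the origin of K^(N+1).  The dual space
   (P^N)^* is the same type: the point H^perp is the line spanned by the
   coefficient vector of an equation of H. *)
Definition proj : Type := {L : {vspace 'rV[K]_N.+1} | \dim L == 1%N}.

Definition line_of (x : proj) : {vspace 'rV[K]_N.+1} := val x.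

Definition homogeneous (p : {mpoly K[N.+1]}) : Prop :=
  exists d : nat, p \is d.-homog.

Definition vanishes_at (p : {mpoly K[N.+1]}) (x : proj) : Prop :=
  forall u, u \in line_of x -> p.@[u 0] = 0.

Definition proj_closed (Z : set proj) : Prop :=
  exists2 I : set {mpoly K[N.+1]}, I `<=` homogeneous &
    Z = [set x | forall p, I p -> vanishes_at p x].

Definition bihomogeneous (p : {mpoly K[N.+1 + N.+1]}) : Prop :=
  exists d e : nat, forall m, m \in msupp p ->
    (\sum_i m (lshift N.+1 i) = d)%N /\ (\sum_i m (rshift N.+1 i) = e)%N.

Definition bivanishes_at (p : {mpoly K[N.+1 + N.+1]}) (z : proj * proj) : Prop :=
  forall u a, u \in line_of z.1 -> a \in line_of z.2 ->
    p.@[row_mx u a 0] = 0.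

Definition biproj_closed (Z : set (proj * proj)) : Prop :=
  exists2 I : set {mpoly K[N.+1 + N.+1]}, I `<=` bihomogeneous &
    Z = [set z | forall p, I p -> bivanishes_at p z].

Definition projective_variety (X : set proj) : Prop :=
  proj_closed X /\ irreducible proj_closed X.

Definition in_ideal (X : set proj) (f : {mpoly K[N.+1]}) : Prop :=
  homogeneous f /\ forall x, X x -> vanishes_at f x.

(* U is the linear subspace of K^(N+1) whose projectivization is the embedded
   projective tangent space to X at x. *)
Definition is_tangent_space (X : set proj) (x : proj)
    (U : {vspace 'rV[K]_N.+1}) : Prop :=
  forall v, v \in U <->
    forall f, in_ideal X f -> forall u, u \in line_of x ->
      \sum_i (f^`M(i)).@[u 0] * v 0 i = 0.

(* Since X is irreducible, its local dimension at x is dim X. *)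
Definition smooth_point (X : set proj) (x : proj) : Prop :=
  X x /\ exists (U : {vspace 'rV[K]_N.+1}) (d : nat),
    [/\ is_tangent_space X x U, dim_eq proj_closed X d & \dim U = d.+1].

Definition hyperplane_contains (h : proj) (U : {vspace 'rV[K]_N.+1}) : Prop :=
  forall a v, a \in line_of h -> v \in U -> \sum_i a 0 i * v 0 i = 0.

Definition conormal_variety (X : set proj) : set (proj * proj) :=
  top_closure biproj_closed
    [set z | smooth_point X z.1 /\
       exists2 U, is_tangent_space X z.1 U & hyperplane_contains z.2 U].

Definition projective_dual (X : set proj) : set proj :=
  [set h | exists x, conormal_variety X (x, h)].

(* The set of closed points of the fibre of I_X -> X^* over h, which
   determines the reduced tangency locus. *)
Definition reduced_tangency_locus (X : set proj) (h : proj) : set proj :=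
  [set x | conormal_variety X (x, h)].

(* The span of S is the projectivization of U, of projective dimension
   \dim U - 1. *)
Definition is_linear_span (S : set proj) (U : {vspace 'rV[K]_N.+1}) : Prop :=
  (forall x, S x -> (line_of x <= U)%VS) /\
  (forall W : {vspace 'rV[K]_N.+1}, (forall x, S x -> (line_of x <= W)%VS) ->
     (U <= W)%VS).

Definition dual_span_locus (X : set proj) (r : int) : set proj :=
  [set h | projective_dual X h /\
     exists2 U, is_linear_span (reduced_tangency_locus X h) U &
       r <= (\dim U)%:Z - 1].

End ProjectiveGeometry.

(* Main.v *)
From HB Require Import structures.
Require Import Defs.
From mathcomp Require Import all_boot all_order all_algebra.
From mathcomp Require Import complex mpoly.
From mathcomp Require Import boolp classical_sets filter reals.
From mathcomp Require Import ring zify.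

(** Let Z be the top of a chain of n + 1 irreducible closed subsets of the
    locus, h its generic point and k = r + 1.  Over h there are k linearly
    independent points x with (x, h) in the conormal variety.  The bound
    (n + 1) + k <= N + 1 holds because the n + 1 independent tangent vectors
    dh of the cone over Z at h are orthogonal to each of these x; that is,
    because the contact form  sum_l x_l dh_l  vanishes on the conormal variety.

    On a pair (x, h) with h tangent at x this is a computation: h is a
    combination sum_j c_j grad g_j(x) of gradients of equations of X, so
    sum_l h_l dx_l = sum_j c_j d(g_j(x)) = 0, while sum_l x_l h_l = 0 by Euler's
    identity.  The difficulty is that (x, h) may lie on the boundary, where the
    conormal variety is only a closure and can be singular: tangent vectors
    there need not be limits of tangent vectors at nearby tangent pairs.

    Tangent vectors of Z at its generic point are derivations D of a field E
    that contains the coordinates of h.  A boundary point w with coordinates in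
    E is the specialization of a tangent pair z over a larger field, and
    [chevalley] gives a valuation ring V containing E such that z and w are
    congruent modulo its maximal ideal.  If D extends to a derivation whose
    logarithmic derivatives lie in V, then congruent elements have congruent
    derivatives, so the identity satisfied by z passes to w; this is
    [conormal_closure_isotropic].

    That extension exists in characteristic zero.  For an algebraic element x
    of least degree ([minimal_degree_adjoin]), the roots of the derivative of
    its minimal polynomial are already in the smaller field, and comparing x
    with the nearest of them excludes cancellation in the formula for D x.  For
    a transcendental x ([log_der_extend]), the derivative has to be chosen in a
    nested family of balls, which has a point after passage to an ultrapower.

    Ultrapowers also provide the generic points: they are algebraically closed,
    and both tangency and membership in a closure can be checked index by index
    ([conormal_closure_ultrapower]), once Hilbert's basis theorem has made the
    equations of X finite in number.  Finally [chain_indep] turns a chain of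
    length n into n + 1 algebraically independent coordinates of the generic
    point, hence into n + 1 independent derivations
    ([alg_indep_dual_ders]). *)

Set Implicit Arguments.
Unset Strict Implicit.
Unset Printing Implicit Defensive.

Import GRing.Theory.

Local Open Scope ring_scope.
Local Open Scope classical_set_scope.

(** * Derivations as graphs in the dual numbers *)

Definition alg_closed (F : fieldType) : Prop :=
  forall p : {poly F}, (1 < size p)%N -> exists x, root p x.

(** A derivation of a subfield is represented by its graph, a set of dual numbers
    [x + (D x) eps]: additivity and Leibniz' rule together say that the graph is
    a subring. *)
Record dual (F : fieldType) := Dual { re : F; eps : F }.

Section DualRing.
Variable F : fieldType.

Definition dual_pair (z : dual F) : F * F := (re z, eps z).
Definition pair_dual (z : F * F) : dual F := Dual z.1 z.2.
Lemma dual_pairK : cancel dual_pair pair_dual. Proof. by case. Qed.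
HB.instance Definition _ := Choice.copy (dual F) (can_type dual_pairK).

Lemma dual_eq (z w : dual F) : re z = re w -> eps z = eps w -> z = w.
Proof. by case: z w => [a b] [c d] /= -> ->. Qed.

Definition dual_add (z w : dual F) := Dual (re z + re w) (eps z + eps w).
Definition dual_opp (z : dual F) := Dual (- re z) (- eps z).
Definition dual_mul (z w : dual F) :=
  Dual (re z * re w) (eps z * re w + re z * eps w).

Lemma dual_addA : associative dual_add.
Proof. by move=> x y z; apply: dual_eq; rewrite /= addrA. Qed.
Lemma dual_addC : commutative dual_add.
Proof. by move=> x y; apply: dual_eq; rewrite /= addrC. Qed.
Lemma dual_add0 : left_id (Dual 0 0) dual_add.
Proof. by move=> x; apply: dual_eq; rewrite /= add0r. Qed.
Lemma dual_addN : left_inverse (Dual 0 0) dual_opp dual_add.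
Proof. by move=> x; apply: dual_eq; rewrite /= addNr. Qed.
HB.instance Definition _ := GRing.isZmodule.Build (dual F)
  dual_addA dual_addC dual_add0 dual_addN.

Lemma dual_mulA : associative dual_mul.
Proof. by move=> x y z; apply: dual_eq => /=; ring. Qed.
Lemma dual_mulC : commutative dual_mul.
Proof. by move=> x y; apply: dual_eq => /=; ring. Qed.
Lemma dual_mul1 : left_id (Dual 1 0) dual_mul.
Proof. by move=> x; apply: dual_eq => /=; ring. Qed.
Lemma dual_mulD : left_distributive dual_mul +%R.
Proof. by move=> x y z; apply: dual_eq => /=; ring. Qed.
Lemma dual_one_neq0 : Dual 1 0 != 0.
Proof. by apply/eqP => /(congr1 (@re F)) /eqP; rewrite oner_eq0. Qed.
HB.instance Definition _ := GRing.Zmodule_isComNzRing.Build (dual F)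
  dual_mulA dual_mulC dual_mul1 dual_mulD dual_one_neq0.

Lemma re_is_zmod_morphism : zmod_morphism (@re F). Proof. by []. Qed.
Lemma re_is_monoid_morphism : monoid_morphism (@re F). Proof. by []. Qed.
HB.instance Definition _ := GRing.isZmodMorphism.Build (dual F) F (@re F)
  re_is_zmod_morphism.
HB.instance Definition _ := GRing.isMonoidMorphism.Build (dual F) F (@re F)
  re_is_monoid_morphism.
Lemma eps_is_zmod_morphism : zmod_morphism (@eps F). Proof. by []. Qed.
HB.instance Definition _ := GRing.isZmodMorphism.Build (dual F) F (@eps F)
  eps_is_zmod_morphism.

Lemma reE a b : re (Dual a b) = a :> F. Proof. by []. Qed.
Lemma epsE a b : eps (Dual a b) = b :> F. Proof. by []. Qed.

Arguments re F d : simpl never.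
Arguments eps F d : simpl never.

Lemma epsM (z w : dual F) : eps (z * w) = eps z * re w + re z * eps w.
Proof. by []. Qed.

(** The first-order Taylor formula.  The first sum is the value at [re z] of the
    polynomial with differentiated coefficients. *)
Lemma eps_horner (q : {poly dual F}) (z : dual F) :
  eps q.[z] = \sum_(i < size q) eps q`_i * re z ^+ i
              + (map_poly (@re F) q)^`().[re z] * eps z.
Proof.
suff H : eps q.[z] = (map_poly (@eps F) q).[re z] + (map_poly (@re F) q)^`().[re z] * eps z.
  rewrite H; congr (_ + _).
  rewrite (horner_coef_wide _ (size_poly _ _)).
  by apply: eq_bigr => i _; rewrite coef_poly ltn_ord.
elim/poly_ind: q => [|q c IH].
  by rewrite !rmorph0 map_poly0 deriv0 !horner0 mul0r addr0.
rewrite hornerMXaddC raddfD /= epsM IH rmorphD rmorphM /= map_polyX map_polyC /=.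
rewrite derivD derivM derivX derivC addr0 mulr1 !hornerE -horner_map /=.
suff -> : map_poly (@eps F) (q * 'X + c%:P) = map_poly (@eps F) q * 'X + (eps c)%:P.
  by rewrite !hornerE; ring.
apply/polyP => i; rewrite coef_map /= !coefD !coefMX !coefC.
by rewrite raddfD /=; case: i => [|i] /=; rewrite ?raddf0 ?coef_map.
Qed.

End DualRing.

Arguments re {F} d : simpl never.
Arguments eps {F} d : simpl never.

(** * Zorn's lemma for properties of finite character *)

(** A property that only involves finitely many elements at a time passes to
    unions of chains, and so has maximal models. *)
Lemma zorn_finitary (T : Type) (G0 : set T) (P : set T -> Prop) :
  P G0 ->
  (forall A, G0 `<=` A ->
     (forall (J : finType) (x : J -> T), (forall j, A (x j)) ->
        exists B, [/\ P B, B `<=` A & forall j, B (x j)]) -> P A) ->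
  exists G, [/\ P G, G0 `<=` G & forall G', P G' -> G `<=` G' -> G' `<=` G].
Proof.
move=> P0 fin; have [C CP tot|A [PA maxA]] := @Zorn_bigcup _ (fun A => P (G0 `|` A)).
  apply: fin => [z|J x Hx]; first by left.
  have Hs (s : seq J) : exists A, [/\ A = set0 \/ C A & forall j, j \in s -> (G0 `|` A) (x j)].
    elim: s => [|j s [A [CA HA]]]; first by exists set0; split=> //; left.
    have [GX|[X CX Xj]] := Hx j.
      by exists A; split=> // k; rewrite inE => /orP[/eqP->|/HA//]; left.
    have AX : A `<=` X \/ X `<=` A.
      by case: CA => [->|CA]; [left|exact: tot].
    case: AX => [AX|XA].
      exists X; split=> [|k]; first by right.
      rewrite inE => /orP[/eqP->|/HA[]]; [by right|by left|by move/AX; right].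
    exists A; split=> // k; rewrite inE => /orP[/eqP->|/HA//].
    by right; exact: XA.
  have [A [CA HA]] := Hs (enum J); exists (G0 `|` A); split=> [|z|j].
  - by case: CA => [->|/CP//]; rewrite setU0.
  - move=> [G0z|Az]; first by left.
    by case: CA Az => [-> //|CA Az]; right; exists A.
  - by apply: HA; rewrite mem_enum.
exists (G0 `|` A); split=> [//|z|G1 H1 sG z G1z]; first by left.
right; apply: contrapT => nAz; apply: (maxA G1); last first.
  rewrite (_ : _ `|` _ = G1) //; apply/seteqP; split=> [t [G0t|//]|t]; last by right.
  by apply: sG; left.
split; last by move/(_ z G1z).
by move=> t At; apply: sG; right.
Qed.

(** * Valuation rings and derivations with bounded logarithmic derivative *)

(** The last clause says that the residue field has characteristic zero. *)
Record val_ring (F : fieldType) (V : set F) : Prop := ValRing {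
  vr1 : V 1;
  vrB : forall x y, V x -> V y -> V (x - y);
  vrM : forall x y, V x -> V y -> V (x * y);
  vr_total : forall x, V x \/ V x^-1;
  vr_nat : forall n, n.+1%:R != 0 :> F /\ V (n.+1%:R^-1) }.

(** In terms of the valuation: the value of [y] is at least that of [x]. *)
Definition vdvd (F : fieldType) (V : set F) (x y : F) : Prop :=
  exists2 c, V c & y = c * x.

Section Valuation.
Variables (F : fieldType) (V : set F).
Hypothesis VV : val_ring V.

Lemma vr0 : V 0.
Proof. by rewrite -(subrr 1); apply: vrB => //; exact: vr1. Qed.
Lemma vrN x : V x -> V (- x).
Proof. by move=> Vx; rewrite -sub0r; apply: vrB => //; exact: vr0. Qed.
Lemma vrD x y : V x -> V y -> V (x + y).
Proof. by move=> Vx Vy; rewrite -(opprK y); apply: vrB => //; exact: vrN. Qed.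

Lemma vdvd_refl x : vdvd V x x.
Proof. by exists 1; [exact: vr1 | rewrite mul1r]. Qed.
Lemma vdvd0 x : vdvd V x 0.
Proof. by exists 0; [exact: vr0 | rewrite mul0r]. Qed.
Lemma vdvd_trans y x z : vdvd V x y -> vdvd V y z -> vdvd V x z.
Proof. by move=> [c Vc ->] [d Vd ->]; exists (d * c); [exact: vrM|rewrite mulrA]. Qed.
Lemma vdvdD x y z : vdvd V x y -> vdvd V x z -> vdvd V x (y + z).
Proof. by move=> [c Vc ->] [d Vd ->]; exists (c + d); [exact: vrD|rewrite mulrDl]. Qed.
Lemma vdvdN x y : vdvd V x y -> vdvd V x (- y).
Proof. by move=> [c Vc ->]; exists (- c); [exact: vrN|rewrite mulNr]. Qed.
Lemma vdvdB x y z : vdvd V x y -> vdvd V x z -> vdvd V x (y - z).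
Proof. by move=> xy xz; apply: vdvdD => //; exact: vdvdN. Qed.
Lemma vdvdM x y z t : vdvd V x y -> vdvd V z t -> vdvd V (x * z) (y * t).
Proof. by move=> [c Vc ->] [d Vd ->]; exists (c * d); [exact: vrM|ring]. Qed.
Lemma vdvd_sum (I : Type) (s : seq I) (P : pred I) (f : I -> F) x :
  (forall i, P i -> vdvd V x (f i)) -> vdvd V x (\sum_(i <- s | P i) f i).
Proof.
move=> H; elim/big_ind: _ => //; [exact: vdvd0 | exact: vdvdD].
Qed.
Lemma vdvd_total x y : vdvd V x y \/ vdvd V y x.
Proof.
have [->|x0] := eqVneq x 0; first by right; exact: vdvd0.
have [->|y0] := eqVneq y 0; first by left; exact: vdvd0.
case: (vr_total VV (y / x)) => H; [left|right].
  by exists (y / x) => //; rewrite divfK.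
by exists (y / x)^-1 => //; rewrite invf_div divfK.
Qed.

(** Values are totally ordered, so some point of a finite list is nearest to
    [x]. *)
Lemma vdvd_closest (x : F) (e : F) (es : seq F) :
  exists2 a, a \in e :: es & forall b, b \in e :: es -> vdvd V (x - b) (x - a).
Proof.
elim: es e => [|e' es IH] e.
  exists e; first exact: mem_head.
  by move=> b; rewrite inE => /eqP->; exact: vdvd_refl.
have [a ain Ha] := IH e'.
case: (vdvd_total (x - e) (x - a)) => H.
  exists a; first by rewrite inE ain orbT.
  by move=> b; rewrite inE => /orP[/eqP->//|]; exact: Ha.
exists e; first exact: mem_head.
move=> b; rewrite inE => /orP[/eqP->|/Ha Hb]; first exact: vdvd_refl.
exact: vdvd_trans Hb H.
Qed.

(** Both [y] and [e = y - (y - e)] are multiples of [y - e], so after the scaling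
    of ['X] by [y] every linear factor is [y - e] times a polynomial over [V]. *)
Lemma vdvd_coef_prod_XsubC (y : F) (es : seq F) :
  (forall e, e \in es -> vdvd V (y - e) y) ->
  forall j, vdvd V (\prod_(e <- es) (y - e))
                   ((\prod_(e <- es) ('X - e%:P))`_j * y ^+ j).
Proof.
elim: es => [|e es IH] H j.
  rewrite !big_nil coef1; case: eqP => [->|_]; last by rewrite mul0r; exact: vdvd0.
  by rewrite mul1r; exact: vdvd_refl.
have {}IH := IH (fun e' es_e' => H e' (mem_behead (s := e :: es) es_e')).
have Hy := H e (mem_head _ _).
have He : vdvd V (y - e) e.
  have {2}-> : e = y - (y - e) by ring.
  by apply: vdvdB => //; exact: vdvd_refl.
rewrite !big_cons (mulrBl _ 'X) coefB coefXM coefCM (mulrBl (y ^+ j)).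
apply: vdvdB; last by rewrite -mulrA; apply: vdvdM.
case: j => [|j] /=; first by rewrite mul0r; exact: vdvd0.
by rewrite exprS mulrCA; apply: vdvdM.
Qed.

End Valuation.

Section LogDerivation.
Variables (F : fieldType) (V : set F).
Hypothesis VV : val_ring V.

(** Bounding [D x / x], and not only [D x], has two merits: it makes a graph
    functional, even when [V] is the whole field, and it can be tested on the
    linear factors of a polynomial expression. *)
Definition log_bounded (z : dual F) : Prop := vdvd V (re z) (eps z).

Record log_der (G : set (dual F)) : Prop := LogDer {
  ld1 : G 1;
  ldB : forall z w, G z -> G w -> G (z - w);
  ldM : forall z w, G z -> G w -> G (z * w);
  ld_bounded : forall z, G z -> log_bounded z }.

Lemma log_boundedM z w : log_bounded z -> log_bounded w -> log_bounded (z * w).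
Proof.
rewrite /log_bounded epsM rmorphM /= => Hz Hw; apply: (vdvdD VV).
  by apply: (vdvdM VV) => //; exact: vdvd_refl.
by apply: (vdvdM VV) => //; exact: vdvd_refl.
Qed.

Section Fixed.
Variable G : set (dual F).
Hypothesis GG : log_der G.

Lemma ld0 : G 0. Proof. by rewrite -(subrr 1); apply: ldB => //; exact: ld1. Qed.
Lemma ldN z : G z -> G (- z).
Proof. by move=> Gz; rewrite -sub0r; apply: ldB => //; exact: ld0. Qed.
Lemma ldD z w : G z -> G w -> G (z + w).
Proof. by move=> Gz Gw; rewrite -(opprK w); apply: ldB => //; exact: ldN. Qed.
Lemma ld_sum (I : Type) (s : seq I) (P : pred I) (f : I -> dual F) :
  (forall i, P i -> G (f i)) -> G (\sum_(i <- s | P i) f i).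
Proof. by move=> H; elim/big_ind: _ => //; [exact: ld0 | exact: ldD]. Qed.
Lemma ldMn z n : G z -> G (z *+ n).
Proof. by move=> Gz; elim: n => [|n IH]; rewrite ?mulrS; [exact: ld0|exact: ldD]. Qed.
Lemma ld_re0 z : G z -> re z = 0 -> z = 0.
Proof.
move=> Gz z0; have [c _] := ld_bounded GG Gz.
by rewrite z0 mulr0 => e0; apply: dual_eq.
Qed.

Definition pover (q : {poly dual F}) : Prop := forall i, G q`_i.

Lemma poverC c : G c -> pover c%:P.
Proof. by move=> Gc i; rewrite coefC; case: ifP => // _; exact: ld0. Qed.
Lemma pover0 : pover 0. Proof. by move=> i; rewrite coef0; exact: ld0. Qed.
Lemma poverX : pover 'X.
Proof. by move=> i; rewrite coefX; case: eqP => _; [exact: ld1|exact: ld0]. Qed.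
Lemma poverD p q : pover p -> pover q -> pover (p + q).
Proof. by move=> Hp Hq i; rewrite coefD; apply: ldD. Qed.
Lemma poverB p q : pover p -> pover q -> pover (p - q).
Proof. by move=> Hp Hq i; rewrite coefB; apply: ldB. Qed.
Lemma poverM p q : pover p -> pover q -> pover (p * q).
Proof. by move=> Hp Hq i; rewrite coefM; apply: ld_sum => j _; apply: ldM. Qed.
Lemma pover_deriv p : pover p -> pover p^`().
Proof. by move=> Hp i; rewrite coef_deriv; apply: ldMn. Qed.
Lemma pover_ind (K : {poly dual F} -> Prop) : K 0 ->
  (forall p c, pover p -> G c -> K p -> K (p * 'X + c%:P)) ->
  forall p, pover p -> K p.
Proof.
move=> K0 KS; elim/poly_ind => [//|p c IH] H.
have Gc : G c by have := H 0%N; rewrite coefD coefMX coefC add0r.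
have Hp : pover p.
  by move=> i; have := H i.+1; rewrite coefD coefMX coefC addr0.
by apply: KS => //; exact: IH.
Qed.
Lemma pover_horner p z : pover p -> G z -> G p.[z].
Proof.
move=> Hp Gz; move: p Hp; apply: pover_ind; first by rewrite horner0; exact: ld0.
by move=> p c _ Gc IH; rewrite !hornerE; apply: ldD => //; apply: ldM.
Qed.
Lemma pover_comp p q : pover p -> pover q -> pover (p \Po q).
Proof.
move=> Hp Hq; move: p Hp; apply: pover_ind; first by rewrite comp_poly0; exact: pover0.
move=> p c _ Gc IH; rewrite comp_poly_MXaddC.
by apply: poverD; [exact: poverM|exact: poverC].
Qed.

Lemma re_lead_neq0 p : pover p -> p != 0 -> re (lead_coef p) != 0.
Proof.
move=> Hp p0; apply: contraNneq p0 => /(ld_re0 (Hp _)) /eqP.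
by rewrite lead_coef_eq0.
Qed.

Lemma size_map_re p : pover p -> size (map_poly re p) = size p.
Proof.
move=> Hp; have [->|p0] := eqVneq p 0; first by rewrite rmorph0 !size_poly0.
by apply: size_map_poly_id0; exact: re_lead_neq0.
Qed.

Lemma pover_factor p A : pover p -> G A ->
  exists2 q, pover q & p = q * ('X - A%:P) + p.[A]%:P.
Proof.
move=> Hp GA; move: p Hp; apply: pover_ind.
  by exists 0; [exact: pover0|rewrite horner0 mul0r addr0].
move=> p c Hp Gc [q Hq Ep]; exists (q * 'X + p.[A]%:P).
  apply: poverD; last by apply: poverC; exact: pover_horner.
  by apply: poverM => //; exact: poverX.
rewrite hornerMXaddC {1}Ep polyCD polyCM; ring.
Qed.

Lemma pover_div (P p : {poly dual F}) : P \is monic -> pover P -> pover p ->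
  exists s r, [/\ pover s, pover r, p = s * P + r & (size r < size P)%N].
Proof.
move=> mP HP; have [n] := ubnP (size p); elim: n p => // n IH p sp Hp.
have [lt|le] := ltnP (size p) (size P).
  by exists 0, p; split => //; [exact: pover0|rewrite mul0r add0r].
have P0 : P != 0 by exact: monic_neq0.
have sP : (0 < size P)%N by rewrite size_poly_gt0.
have p0 : p != 0 by rewrite -size_poly_gt0 (leq_trans sP).
pose t := (lead_coef p)%:P * 'X^(size p - size P).
have Ht : pover t.
  apply: poverM; first by apply: poverC; exact: Hp.
  by move=> i; rewrite coefXn; case: eqP => _; [exact: ld1|exact: ld0].
have lt : (size (p - t * P)%R < size p)%N.
  have spp : ((size p).-1.+1 = size p)%N by rewrite prednK ?size_poly_gt0.
  rewrite -[X in (_ < X)%N]spp ltnS.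
  apply/leq_sizeP => j; rewrite leq_eqVlt => /orP[/eqP <-|].
    rewrite coefB /t -mulrA coefCM coefXnM.
    have -> : ((size p).-1 < size p - size P)%N = false.
      by rewrite ltnNge -ltnS prednK ?size_poly_gt0 // ltn_subrL sP size_poly_gt0 p0.
    have -> : ((size p).-1 - (size p - size P) = (size P).-1)%N.
      by move: le sP; lia.
    by rewrite -/(lead_coef P) (monicP mP) mulr1 subrr.
  rewrite spp => lj; rewrite coefB /t -mulrA coefCM coefXnM nth_default //.
  case: ifP => // lj'; first by rewrite mulr0 subr0.
  rewrite [P`__]nth_default ?mulr0 ?subr0 //.
  by move: lj le; move: (size p) (size P) => a b; clear; lia.
have Hpt : pover (p - t * P) by apply: poverB => //; apply: poverM.
have [|s [r [Hs Hr E sr]]] := IH _ _ Hpt; first exact: leq_trans lt _.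
exists (s + t), r; split => //; first exact: poverD.
by rewrite mulrDl addrAC -E subrK.
Qed.

(** Sizes are degrees plus one: this concerns degrees from [1] to [n - 2]. *)
Definition splits_upto (n : nat) : Prop :=
  forall q, pover q -> (1 < size q < n)%N -> exists2 A, G A & root q A.

Lemma pover_root (q : {poly dual F}) (A : dual F) : pover q -> G A -> root q A ->
  exists2 q1, pover q1 & q = q1 * ('X - A%:P).
Proof.
move=> Hq GA /rootP qA; have [q1 H1 E] := pover_factor Hq GA.
by exists q1 => //; rewrite {1}E qA addr0.
Qed.

Lemma splits_prod n q : splits_upto n -> pover q -> q != 0 -> (size q < n)%N ->
  exists c (s : seq (dual F)), [/\ G c, forall A, A \in s -> G A
    & q = c *: \prod_(A <- s) ('X - A%:P)].
Proof.
move=> Hn; have [m] := ubnP (size q); elim: m q => // m IH q sq Hq q0 qn.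
have [le1|lt1] := leqP (size q) 1.
  exists q`_0, [::]; split => //; rewrite big_nil alg_polyC.
  exact: size1_polyC.
have [|A GA qA] := Hn q Hq; first by rewrite lt1.
have [q1 H1 E] := pover_root Hq GA qA.
have q10 : q1 != 0 by apply: contraNneq q0 => q10; rewrite E q10 mul0r.
have sE : size q = (size q1).+1.
  by rewrite E size_Mmonic ?monicXsubC // size_XsubC addn2.
have [||c [s [Gc Gs E1]]] := IH q1 _ H1 q10.
- by move: sq; rewrite sE ltnS.
- by apply: ltn_trans qn; rewrite sE.
exists c, (A :: s); split => //.
  by move=> B; rewrite inE => /orP[/eqP->|/Gs].
by rewrite E E1 big_cons mulrC scalerAr.
Qed.

(** The logarithmic derivative of a product is the sum of those of its factors. *)
Lemma splits_log_bounded n z : splits_upto n ->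
  (forall A, G A -> log_bounded (z - A)) ->
  forall q, pover q -> (size q < n)%N -> log_bounded q.[z].
Proof.
move=> Hn Hz q Hq qn; have [->|q0] := eqVneq q 0.
  by rewrite horner0; apply: (ld_bounded GG); exact: ld0.
have [c [s [Gc Gs ->]]] := splits_prod Hn Hq q0 qn.
rewrite hornerZ; apply: log_boundedM; first exact: (ld_bounded GG).
rewrite horner_prod big_seq; elim/big_ind: _.
- by apply: (ld_bounded GG); exact: ld1.
- by move=> *; exact: log_boundedM.
- by move=> A As; rewrite hornerXsubC; apply: Hz; exact: Gs.
Qed.

(** The new graph consists of the values at [z] of the polynomials over [G]. *)
Lemma log_der_adjoin z : (forall q, pover q -> log_bounded q.[z]) ->
  exists G1, [/\ log_der G1, G `<=` G1 & G1 z].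
Proof.
move=> H; exists [set w | exists2 q, pover q & w = q.[z]]; split.
- split.
  + by exists 1; [apply: poverC; exact: ld1|rewrite hornerC].
  + by move=> _ _ [p Hp ->] [q Hq ->]; exists (p - q); rewrite ?hornerE //; exact: poverB.
  + by move=> _ _ [p Hp ->] [q Hq ->]; exists (p * q); rewrite ?hornerM //; exact: poverM.
  + by move=> _ [p Hp ->]; exact: H.
- by move=> w Gw; exists w%:P; [exact: poverC|rewrite hornerC].
- by exists 'X; [exact: poverX|rewrite hornerX].
Qed.

End Fixed.

End LogDerivation.

(** * Extension to algebraic elements *)

Section Maximal.
Variables (F : fieldType) (V : set F).
Hypothesis VV : val_ring V.

Definition log_max (G : set (dual F)) : Prop :=
  log_der V G /\ forall G1, log_der V G1 -> G `<=` G1 -> G1 `<=` G.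

Lemma log_max_exists G0 : log_der V G0 -> exists2 G, log_max G & G0 `<=` G.
Proof.
move=> H0; have [|G [GG sG maxG]] := zorn_finitary H0; last by exists G.
move=> A sA fin.
have pair z w : A z -> A w -> exists B, [/\ log_der V B, B `<=` A, B z & B w].
  move=> Az Aw; have [|B [HB BA Bx]] := fin bool (fun b => if b then z else w).
    by case.
  by exists B; split=> //; [exact: (Bx true)|exact: (Bx false)].
split.
- exact/sA/(ld1 H0).
- by move=> z w Az Aw; have [B [HB BA Bz Bw]] := pair z w Az Aw; apply/BA/(ldB HB).
- by move=> z w Az Aw; have [B [HB BA Bz Bw]] := pair z w Az Aw; apply/BA/(ldM HB).
- by move=> z Az; have [B [HB BA Bz _]] := pair z z Az Az; exact: ld_bounded HB _ Bz.
Qed.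

Variable G : set (dual F).
Hypothesis mG : log_max G.
Let GG : log_der V G := proj1 mG.

(** The logarithmic derivative of a quotient is again a difference of elements of
    [V], so all quotients can be adjoined at once. *)
Lemma log_max_div q r w : G q -> G r -> re r != 0 -> w * r = q -> G w.
Proof.
move=> Gq Gr r0 E.
pose G1 := [set w | exists q r, [/\ G q, G r, re r != 0 & w * r = q]].
have G1G : log_der V G1.
  split.
  - by exists 1, 1; split; rewrite ?mul1r ?rmorph1 ?oner_eq0 //; exact: ld1 GG.
  - move=> z t [a [b [Ga Gb b0 E1]]] [c [d [Gc Gd d0 E2]]].
    exists (a * d - c * b), (b * d); split.
    + by apply: (ldB GG); apply: (ldM GG).
    + exact: (ldM GG).
    + by rewrite rmorphM mulf_neq0.
    + by rewrite -E1 -E2; ring.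
  - move=> z t [a [b [Ga Gb b0 E1]]] [c [d [Gc Gd d0 E2]]].
    exists (a * c), (b * d); split.
    + exact: (ldM GG).
    + exact: (ldM GG).
    + by rewrite rmorphM mulf_neq0.
    + by rewrite -E1 -E2; ring.
  - move=> z [a [b [Ga Gb b0 E1]]].
    have [c Vc Hc] := ld_bounded GG Gb; have [d Vd Hd] := ld_bounded GG Ga.
    exists (d - c); first exact: vrB.
    apply: (mulIf b0); move: Hd; rewrite -E1 epsM rmorphM /= Hc => Hd.
    have -> : eps z * re b = d * (re z * re b) - re z * (c * re b).
      by rewrite -Hd addrK.
    ring.
have sG : G `<=` G1.
  by move=> z Gz; exists z, 1; split; rewrite ?mulr1 ?rmorph1 ?oner_eq0 //; exact: ld1 GG.
by apply: (proj2 mG _ G1G sG); exists q, r.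
Qed.

Hypothesis cF : alg_closed F.

(** Here [x] has the least degree among the elements that are algebraic over the
    field of first components of [G] but not in it, and [P] is its minimal
    polynomial.  Polynomials of lower degree then split; this applies to the
    derivative of [P], whose roots serve as reference points near [x]. *)
Section MinimalDegree.
Variables (n : nat) (P : {poly dual F}) (x : F).
Hypotheses (sn : splits_upto G n) (sP : size P = n) (mP : P \is monic)
  (HP : pover G P) (rx : root (map_poly re P) x)
  (xG : forall A, G A -> re A != x).

(* A root of a monic polynomial of degree one is minus its constant term. *)
Let n3 : (2 < n)%N.
Proof.
rewrite ltnNge; apply/negP => n2.
have P1 : P`_1 = 1.
  have s2 : size P = 2.
    apply/eqP; rewrite eqn_leq sP n2 -sP -(size_map_re GG HP) (root_size_gt1 _ rx) //.
    by rewrite -size_poly_eq0 (size_map_re GG HP) size_poly_eq0 monic_neq0.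
  by have := monicP mP; rewrite lead_coefE s2.
have EP : P = 'X + (P`_0)%:P.
  apply/polyP => i; rewrite coefD coefX coefC.
  case: i => [|[|i]] /=; rewrite ?add0r ?addr0 ?P1 //.
  by rewrite nth_default // sP (leq_trans n2).
have /eqP := xG (ldN GG (HP 0%N)); apply.
move/rootP: rx; rewrite EP rmorphD /= map_polyX map_polyC /= !hornerE => /eqP.
by rewrite coefD coefX coefC add0r rmorphN addr_eq0 => /eqP ->.
Qed.

Let dP := map_poly re P^`().

Let dP_prod : exists c (es : seq (dual F)), [/\ c != 0, es != [::],
  forall E, E \in es -> G E & dP = c *: \prod_(E <- es) ('X - (re E)%:P)].
Proof.
have HdP := pover_deriv GG HP.
have cn : re P^`()`_n.-2 != 0.
  have -> : P^`()`_n.-2 = n.-1%:R.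
    rewrite coef_deriv; have -> : n.-2.+1 = (size P).-1 by rewrite sP; move: n3; lia.
    by rewrite -/(lead_coef P) (monicP mP) sP.
  rewrite rmorph_nat; have [+ _] := vr_nat VV n.-2.
  by have -> : n.-2.+1 = n.-1 by move: n3; lia.
have dP0 : P^`() != 0 by apply: contraNneq cn => ->; rewrite coef0 rmorph0.
have sdP : (size P^`() < n)%N by rewrite -sP; apply: lt_size_deriv; exact: monic_neq0.
have [c [s [Gc Gs E]]] := splits_prod GG sn HdP dP0 sdP.
have EE : dP = re c *: \prod_(A <- s) ('X - (re A)%:P).
  rewrite /dP E map_polyZ rmorph_prod /=; congr (_ *: _).
  by apply: eq_bigr => A _; rewrite rmorphB /= map_polyX map_polyC.
exists (re c), s; split => //.
  apply: contraNneq cn => c0; have := congr1 (fun p : {poly F} => p`_n.-2) EE.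
  by rewrite coef_map /= c0 scale0r coef0 => ->.
apply: contraTneq n3 => s0; rewrite -leqNgt.
have cX : P^`()`_n.-2 = (c%:P)`_n.-2 by rewrite E s0 big_nil alg_polyC.
move: cn; rewrite cX coefC; case: (n.-2 =P 0%N) => [|_]; last by rewrite rmorph0 eqxx.
by move=> n2 _; rewrite -subn_eq0 subn2 n2.
Qed.

Let dPx : dP.[x] != 0.
Proof.
have [c [es [c0 _ Ges ->]]] := dP_prod.
rewrite hornerZ mulf_neq0 // horner_prod big_seq prodf_seq_neq0.
apply/allP => E _; apply/implyP => Ees; rewrite hornerXsubC subr_eq0 eq_sym.
by apply: xG; exact: Ges.
Qed.

(* The second component is the only one for which [P] vanishes at [z0]. *)
Let z0 : dual F := Dual x (- eps P.[Dual x 0] / dP.[x]).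

Let Pz0 : P.[z0] = 0.
Proof.
apply: dual_eq; rewrite ?rmorph0 ?raddf0; first by rewrite -horner_map; exact/rootP.
have E y : eps P.[Dual x y] = eps P.[Dual x 0] + dP.[x] * y.
  by rewrite !eps_horner !reE !epsE deriv_map /dP mulr0 addr0.
by rewrite E mulNr mulrN mulrCA divff ?mulr1 ?subrr.
Qed.

(** Put [y = x - re A] and [Q(Y) = P(re A + Y)], so that [Q(y) = 0] and
    [Q'(y) D(y) = - sum_j D(q_j) y^j] with each [D(q_j)] a multiple of [q_j].
    When no root of [P'] is nearer to [x] than [re A], the factors of [Q'(y)] show
    no cancellation, so each [q_j y^j] is a multiple of [y Q'(y)]; passing from
    the coefficients of [Q'] to those of [Q] divides by integers, which are
    units of [V].  Hence [D(y)] is a multiple of [y]. *)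
Let closest_bounded (A : dual F) (es : seq (dual F)) (c : F) :
  dP = c *: \prod_(E <- es) ('X - (re E)%:P) -> G A ->
  (forall E, E \in es -> vdvd V (x - re E) (x - re A)) ->
  log_bounded V (z0 - A).
Proof.
move=> EdP GA clo; pose Q := P \Po ('X + A%:P); pose y := x - re A.
have HQ : pover G Q.
  apply: (pover_comp GG HP); apply: (poverD GG); [exact: (poverX GG)|exact: (poverC GG)].
have Qy : Q.[z0 - A] = 0 by rewrite horner_comp !hornerE subrK Pz0.
pose Q0 := map_poly re Q.
have EQ0 : Q0^`() = c *: \prod_(e <- [seq re E - re A | E <- es]) ('X - e%:P).
  rewrite /Q0 /Q map_comp_poly deriv_comp rmorphD /= map_polyX map_polyC /=.
  rewrite derivD derivX derivC addr0 mulr1 deriv_map -/dP EdP comp_polyZ.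
  congr (_ *: _); rewrite big_map rmorph_prod /=; apply: eq_bigr => E _.
  by rewrite rmorphB /= comp_polyX comp_polyC polyCB opprB addrA.
have Q0y : Q0^`().[y] = dP.[x].
  rewrite EQ0 EdP !hornerZ !horner_prod big_map; congr (_ * _).
  by apply: eq_bigr => E _; rewrite !hornerXsubC opprB addrA subrK.
have coefQ' j : vdvd V Q0^`().[y] (Q0^`()`_j * y ^+ j).
  rewrite EQ0 hornerZ coefZ -mulrA; apply: (vdvdM VV); first exact: vdvd_refl.
  rewrite horner_prod; under eq_bigr => e _ do rewrite hornerXsubC.
  apply: (vdvd_coef_prod_XsubC VV) => _ /mapP[E Ees ->].
  by rewrite opprB addrA subrK; exact: clo.
have coefQS j : vdvd V (y * Q0^`().[y]) (Q0`_j.+1 * y ^+ j.+1).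
  have [n0 Vn] := vr_nat VV j.
  have -> : Q0`_j.+1 * y ^+ j.+1 = y * (j.+1%:R^-1 * (Q0^`()`_j * y ^+ j)).
    rewrite coef_deriv exprS -[Q0`_j.+1 *+ _]mulr_natl.
    by move: (j.+1%:R) n0 => m m0; field.
  apply: (vdvdM VV); first exact: vdvd_refl.
  apply: (vdvd_trans VV (coefQ' j)).
  by exists j.+1%:R^-1.
have Q0y0 : Q0.[y] = 0.
  by rewrite -[y]/(re (z0 - A)) horner_map Qy rmorph0.
have coefQ j : vdvd V (y * Q0^`().[y]) (Q0`_j * y ^+ j).
  (* The constant coefficient is controlled by the others because Q(y) = 0. *)
  case: j => [|j //]; rewrite expr0 mulr1.
  move: Q0y0; rewrite (horner_coef_wide _ (leqnSn _)) big_ord_recl expr0 mulr1.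
  move/eqP; rewrite addr_eq0 => /eqP ->; apply: (vdvdN VV).
  by apply: (vdvd_sum VV) => i _; exact: coefQS.
have := congr1 (@eps F) Qy; rewrite eps_horner -[re (z0 - A)]/y -/Q0 raddf0.
move/eqP; rewrite addrC addr_eq0 => /eqP Ee.
have : vdvd V (y * Q0^`().[y]) (Q0^`().[y] * eps (z0 - A)).
  rewrite Ee; apply: (vdvdN VV); apply: (vdvd_sum VV) => i _.
  apply: (vdvd_trans VV (coefQ i)); rewrite /Q0 coef_map.
  by apply: (vdvdM VV); [exact: ld_bounded (HQ i)|exact: vdvd_refl].
rewrite Q0y => -[d Vd Ed]; exists d => //.
by apply: (mulfI dPx); rewrite Ed -[re (z0 - A)]/y; ring.
Qed.

(** If [re A] is not covered by the previous lemma, the root [re E] of [P'] that is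
    nearest to [x] is, and [x - re A = (x - re E) + (re E - re A)], where [x - re A]
    has the smallest value of the three. *)
Lemma minimal_degree_adjoin : exists G1, [/\ log_der V G1, G `<=` G1 & exists2 A, G1 A & re A = x].
Proof.
have [c [es [c0 es0 Ges EdP]]] := dP_prod.
have bounded A : G A -> log_bounded V (z0 - A).
  move=> GA; case: es es0 Ges EdP => // E0 es _ Ges EdP.
  have [b bin Hb] := vdvd_closest VV x (re E0) (map re es).
  move: bin; rewrite -map_cons => /mapP[E Ees eE]; rewrite {b}eE in Hb.
  have HE E' : E' \in E0 :: es -> vdvd V (x - re E') (x - re E).
    by move=> ?; apply: Hb; rewrite -map_cons map_f.
  have GE := Ges _ Ees.
  case: (vdvd_total VV (x - re E) (x - re A)) => H.
    apply: (closest_bounded EdP GA) => E' /HE H'; exact: (vdvd_trans VV H').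
  have -> : z0 - A = (z0 - E) + (E - A) by rewrite addrA subrK.
  rewrite /log_bounded [eps _]raddfD; apply: (vdvdD VV).
    have := closest_bounded EdP GE HE; apply: (vdvd_trans VV).
    by rewrite [re (_ + _)](_ : _ = x - re A) // addrA subrK.
  apply: (vdvd_trans VV _ (ld_bounded GG (ldB GG GE GA))).
  rewrite [re (_ + _)](_ : _ = x - re A); last by rewrite addrA subrK.
  rewrite (_ : re (E - A) = (x - re A) - (x - re E)); last first.
    by rewrite rmorphB /=; ring.
  by apply: (vdvdB VV) => //; exact: vdvd_refl.
have [|G1 [H1 s1 G1z]] := log_der_adjoin GG (z := z0).
  move=> q Hq; have [s [r [Hs Hr -> sr]]] := pover_div GG mP HP Hq.
  rewrite hornerD hornerM Pz0 mulr0 add0r.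
  by apply: (splits_log_bounded VV GG sn bounded) => //; rewrite -sP.
by exists G1; split => //; exists z0.
Qed.

End MinimalDegree.

(** The field of first components of a maximal graph is algebraically closed,
    since otherwise an element of minimal degree could be adjoined. *)
Lemma log_max_splits n : splits_upto G n.
Proof.
elim: n => [q _|n IH q Hq]; first by rewrite ltn0 andbF.
case/andP => q1; rewrite ltnS leq_eqVlt => /orP[/eqP qn|qn]; last first.
  by apply: IH => //; rewrite q1.
have q0 : q != 0 by rewrite -size_poly_gt0; apply: leq_trans q1.
have [x rx] : exists x, root (map_poly re q) x by apply: cF; rewrite (size_map_re GG).
have [[A GA Ax]|nA] := pselect (exists2 A, G A & re A = x).
  exists A => //; apply/rootP; apply: (ld_re0 GG); first exact: pover_horner GG _ _ Hq GA.
  by rewrite -horner_map /= Ax; exact/rootP.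
have l0 := re_lead_neq0 GG Hq q0.
pose l : dual F := Dual (re (lead_coef q))^-1 (- eps (lead_coef q) / re (lead_coef q) ^+ 2).
have lq : l * lead_coef q = 1.
  apply: dual_eq; rewrite ?epsM ?rmorphM ?rmorph1 /=; first by rewrite mulVf.
  by rewrite /l /eps /re /= -/(re _) -/(eps _); field.
have Gl : G l by apply: (log_max_div (ld1 GG) (Hq (size q).-1) l0 lq).
have HP : pover G (l *: q) by move=> i; rewrite coefZ; apply: (ldM GG).
have sP : size (l *: q) = n.
  rewrite -qn; apply/eqP; rewrite eqn_leq size_scale_leq leqNgt; apply/negP => lt.
  have := congr1 id lq; rewrite lead_coefE -coefZ nth_default; last first.
    by rewrite -ltnS prednK // size_poly_gt0.
  by move/eqP; rewrite eq_sym oner_eq0.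
have mP : l *: q \is monic by rewrite monicE lead_coefE sP -qn coefZ -lead_coefE lq.
have rP : root (map_poly re (l *: q)) x by rewrite map_polyZ rootE hornerZ (rootP rx) mulr0.
have [A GA|G1 [H1 s1 [A G1A Ax]]] := minimal_degree_adjoin IH sP mP HP rP.
  by apply/eqP => Ax; apply: nA; exists A.
by case: nA; exists A => //; exact: (proj2 mG _ H1 s1).
Qed.

End Maximal.

(** * Ultrapowers of a field *)

Record ultra (I : Type) := Ultra {
  uset : set_system I;
  ultraP : UltraFilter uset }.

Definition ae (I : Type) (U : ultra I) (P : I -> Prop) : Prop :=
  uset U [set i | P i].

Section AlmostEverywhere.
Variables (I : Type) (U : ultra I).

#[local] Instance FU : ProperFilter (uset U) := @ultra_proper _ _ (ultraP U).

Lemma aeT (P : I -> Prop) : (forall i, P i) -> ae U P.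
Proof.
move=> H; rewrite /ae (_ : mkset _ = setT); first exact: filterT.
by apply/seteqP; split=> i _ /=.
Qed.
Lemma ae_mono (P Q : I -> Prop) : ae U P -> (forall i, P i -> Q i) -> ae U Q.
Proof. by move=> HP H; apply: filterS HP => i; exact: H. Qed.
Lemma ae_and (P Q : I -> Prop) : ae U P -> ae U Q -> ae U (fun i => P i /\ Q i).
Proof. by move=> HP HQ; exact: (filterI HP HQ). Qed.
Lemma ae_false : ~ ae U (fun _ => False).
Proof. by move=> H; have [i []] := @filter_ex _ _ FU _ H. Qed.
Lemma ae_ex (P : I -> Prop) : ae U P -> exists i, P i.
Proof. by move=> H; have [i Pi] := @filter_ex _ _ FU _ H; exists i. Qed.
Lemma ae_orC (P : I -> Prop) : ae U P \/ ae U (fun i => ~ P i).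
Proof. exact: (in_ultra_setVsetC [set i | P i] (ultraP U)). Qed.
Lemma ae_or (P Q : I -> Prop) : ae U (fun i => P i \/ Q i) -> ae U P \/ ae U Q.
Proof.
move=> H; case: (ae_orC P) => HP; [by left|right].
by apply: ae_mono (ae_and H HP) _ => i [[]].
Qed.
Lemma ae_choice (T : Type) (t : T) (Q : I -> T -> Prop) :
  ae U (fun i => exists y, Q i y) -> exists f : I -> T, ae U (fun i => Q i (f i)).
Proof.
move=> H; have /choice[f Hf] : forall i, exists y, (exists y', Q i y') -> Q i y.
  move=> i; have [[y Hy]|N] := pselect (exists y, Q i y); first by exists y.
  by exists t => /N.
by exists f; apply: ae_mono H _ => i; exact: Hf.
Qed.

End AlmostEverywhere.

Lemma ultra_exists (I J : Type) (j0 : J) (B : J -> set I) :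
  (forall j, B j !=set0) -> (forall j k, exists l, B l `<=` B j `&` B k) ->
  exists U : ultra I, forall j, ae U (B j).
Proof.
move=> B0 BI.
have FF : ProperFilter (filter_from setT B).
  apply: filter_from_proper; last by move=> j _; exact: B0.
  apply: filter_from_filter; first by exists j0.
  by move=> j k _ _; have [l Hl] := BI j k; exists l.
have [U [UU sU]] := ultraFilterLemma FF.
by exists (Ultra UU) => j; apply: sU; exists j.
Qed.

Section Ultrapower.
Local Open Scope quotient_scope.
Variables (I : Type) (U : ultra I) (K : fieldType).

Definition ueq (f g : I -> K) : bool := `[< ae U (fun i => f i = g i) >].

Lemma ueq_refl : reflexive ueq. Proof. by move=> f; apply/asboolP; exact: aeT. Qed.
Lemma ueq_sym : ssrbool.symmetric ueq.
Proof.
move=> f g; apply/idP/idP => /asboolP H; apply/asboolP;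
  by apply: ae_mono H _ => i ->.
Qed.
Lemma ueq_trans : transitive ueq.
Proof.
move=> g f h /asboolP H1 /asboolP H2; apply/asboolP.
by apply: ae_mono (ae_and H1 H2) _ => i [-> ->].
Qed.

Canonical ueq_equiv := EquivRel ueq ueq_refl ueq_sym ueq_trans.

Definition upow : Type := {eq_quot ueq_equiv}.
HB.instance Definition _ := Choice.on upow.
HB.instance Definition _ := EqQuotient.on upow.

Definition cl (f : I -> K) : upow := \pi_upow f.
Definition rep (x : upow) : I -> K := repr x.

Lemma clP f g : cl f = cl g <-> ae U (fun i => f i = g i).
Proof. by split=> [/eqmodP/asboolP|H] //; apply/eqmodP/asboolP. Qed.
Lemma repK x : cl (rep x) = x. Proof. exact: reprK. Qed.
Lemma clK f : ae U (fun i => rep (cl f) i = f i).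
Proof. by apply/clP; exact: repK. Qed.
Lemma clW (P : upow -> Prop) : (forall f, P (cl f)) -> forall x, P x.
Proof. by move=> H x; rewrite -(repK x). Qed.

Definition uadd x y := cl (fun i => rep x i + rep y i).
Definition umul x y := cl (fun i => rep x i * rep y i).
Definition uopp x := cl (fun i => - rep x i).
Definition uinv x := cl (fun i => (rep x i)^-1).

Lemma cl_add f g : uadd (cl f) (cl g) = cl (fun i => f i + g i).
Proof. by apply/clP; apply: ae_mono (ae_and (clK f) (clK g)) _ => i [-> ->]. Qed.
Lemma cl_mul f g : umul (cl f) (cl g) = cl (fun i => f i * g i).
Proof. by apply/clP; apply: ae_mono (ae_and (clK f) (clK g)) _ => i [-> ->]. Qed.
Lemma cl_opp f : uopp (cl f) = cl (fun i => - f i).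
Proof. by apply/clP; apply: ae_mono (clK f) _ => i ->. Qed.
Lemma cl_inv f : uinv (cl f) = cl (fun i => (f i)^-1).
Proof. by apply/clP; apply: ae_mono (clK f) _ => i ->. Qed.

Ltac upow_ring := repeat (elim/clW => ?); rewrite ?(cl_add, cl_mul, cl_opp);
  rewrite ?(cl_add, cl_mul, cl_opp); apply/clP/aeT => i; ring.

Lemma uaddA : associative uadd. Proof. by upow_ring. Qed.
Lemma uaddC : commutative uadd. Proof. by upow_ring. Qed.
Lemma uadd0 : left_id (cl (fun _ => 0)) uadd. Proof. by upow_ring. Qed.
Lemma uaddN : left_inverse (cl (fun _ => 0)) uopp uadd. Proof. by upow_ring. Qed.
HB.instance Definition _ := GRing.isZmodule.Build upow uaddA uaddC uadd0 uaddN.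

Lemma umulA : associative umul. Proof. by upow_ring. Qed.
Lemma umulC : commutative umul. Proof. by upow_ring. Qed.
Lemma umul1 : left_id (cl (fun _ => 1)) umul. Proof. by upow_ring. Qed.
Lemma umulD : left_distributive umul uadd. Proof. by upow_ring. Qed.
Lemma uone_neq0 : cl (fun _ => 1) != cl (fun _ => 0).
Proof.
apply/eqP => /clP H; apply: (@ae_false _ U).
by apply: ae_mono H _ => i /eqP; rewrite oner_eq0.
Qed.
HB.instance Definition _ := GRing.Zmodule_isComNzRing.Build upow
  umulA umulC umul1 umulD uone_neq0.

Lemma umulV x : x != 0 -> umul (uinv x) x = cl (fun _ => 1).
Proof.
elim/clW: x => f f0; rewrite cl_inv cl_mul; apply/clP.
case: (ae_orC U (fun i => f i = 0)) => H; first by case/eqP: f0; apply/clP.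
by apply: ae_mono H _ => i /eqP; exact: mulVf.
Qed.
Lemma uinv0 : uinv 0 = 0.
Proof. by rewrite /uinv; apply/clP; apply: ae_mono (clK (fun _ => 0)) _ => i ->; rewrite invr0. Qed.
HB.instance Definition _ := GRing.ComNzRing_isField.Build upow umulV uinv0.

Lemma clD f g : cl f + cl g = cl (fun i => f i + g i). Proof. exact: cl_add. Qed.
Lemma clM f g : cl f * cl g = cl (fun i => f i * g i). Proof. exact: cl_mul. Qed.
Lemma clN f : - cl f = cl (fun i => - f i). Proof. exact: cl_opp. Qed.
Lemma clV f : (cl f)^-1 = cl (fun i => (f i)^-1). Proof. exact: cl_inv. Qed.
Lemma cl0P f : cl f = 0 <-> ae U (fun i => f i = 0). Proof. exact: clP. Qed.

Definition diag (x : K) : upow := cl (fun _ => x).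
Lemma diag_is_zmod_morphism : zmod_morphism diag.
Proof. by move=> x y; rewrite /diag clN clD. Qed.
Lemma diag_is_monoid_morphism : monoid_morphism diag.
Proof. by split=> // x y; rewrite /diag clM. Qed.
HB.instance Definition _ := GRing.isZmodMorphism.Build K upow diag diag_is_zmod_morphism.
HB.instance Definition _ := GRing.isMonoidMorphism.Build K upow diag diag_is_monoid_morphism.

Lemma cl_sum (J : Type) (s : seq J) (P : pred J) (F : J -> I -> K) :
  \sum_(j <- s | P j) cl (F j) = cl (fun i => \sum_(j <- s | P j) F j i).
Proof.
elim: s => [|j s IH].
  by rewrite big_nil; apply/clP/aeT => i; rewrite big_nil.
rewrite big_cons; case: ifP => Pj; rewrite IH ?clD; apply/clP/aeT => i;
  by rewrite big_cons Pj.
Qed.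
Lemma cl_prod (J : Type) (s : seq J) (P : pred J) (F : J -> I -> K) :
  \prod_(j <- s | P j) cl (F j) = cl (fun i => \prod_(j <- s | P j) F j i).
Proof.
elim: s => [|j s IH].
  by rewrite big_nil; apply/clP/aeT => i; rewrite big_nil.
rewrite big_cons; case: ifP => Pj; rewrite IH ?clM; apply/clP/aeT => i;
  by rewrite big_cons Pj.
Qed.
Lemma cl_exp f n : cl f ^+ n = cl (fun i => f i ^+ n).
Proof.
elim: n => [|n IH]; last first.
  by rewrite exprS IH clM; apply/clP/aeT => i; rewrite exprS.
by rewrite expr0 -[1]/(cl (fun _ => 1)); apply/clP/aeT => i; rewrite expr0.
Qed.

Lemma upow_alg_closed : alg_closed K -> alg_closed upow.
Proof.
move=> cK p sp; pose n := size p.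
have l0 : p`_n.-1 != 0 by rewrite -/(lead_coef p) lead_coef_eq0 -size_poly_gt0 (ltn_trans _ sp).
pose P i := \poly_(j < n) rep p`_j i.
have l0' : ae U (fun i => rep p`_n.-1 i != 0).
  case: (ae_orC U (fun i => rep p`_n.-1 i = 0)) => H.
    by case/eqP: l0; rewrite -(repK p`_n.-1); apply/cl0P.
  by apply: ae_mono H _ => i /eqP.
have [|x Hx] := @ae_choice _ U K 0 (fun i x => root (P i) x).
  apply: ae_mono l0' _ => i li; apply: cK.
  by rewrite /P (@size_poly_eq _ n (fun j => rep p`_j i) li).
exists (cl x); apply/rootP; rewrite horner_coef.
under eq_bigr => j _ do rewrite -[p`_j]repK cl_exp clM.
rewrite cl_sum; apply/cl0P; apply: ae_mono Hx _ => i /rootP.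
by rewrite (horner_coef_wide _ (size_poly _ _)) => E; rewrite -[RHS]E;
  apply: eq_bigr => j _; rewrite coef_poly ltn_ord.
Qed.

(** Evaluation is computed index by index.  The inclusion of supports makes all
    the sums range over the same finite set of monomials. *)
Lemma cl_meval n (P : I -> {mpoly K[n]}) (Q : {mpoly upow[n]}) (z : 'I_n -> I -> K) :
  (forall m, cl (fun i => (P i)@_m) = Q@_m) ->
  (forall i, {subset msupp (P i) <= msupp Q}) ->
  Q.@[fun k => cl (z k)] = cl (fun i => (P i).@[fun k => z k i]).
Proof.
move=> PQ sP; rewrite mevalE.
under eq_bigr => m _ do under eq_bigr => k _ do rewrite cl_exp.
under eq_bigr => m _ do rewrite cl_prod -PQ clM.
rewrite cl_sum; apply/clP/aeT => i; rewrite mevalE.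
rewrite [RHS](bigID (mem (msupp Q))) /= [X in _ + X]big1_seq ?addr0; last first.
  by move=> m /andP[mQ /sP mP]; rewrite mP in mQ.
rewrite -[RHS]big_filter; rewrite [LHS](bigID (mem (msupp (P i)))) /= [X in _ + X]big1 ?addr0.
  rewrite -[LHS]big_filter; apply: perm_big; apply: uniq_perm.
  - exact/filter_uniq/msupp_uniq.
  - exact/filter_uniq/msupp_uniq.
  - by move=> m; rewrite !mem_filter andbC.
by move=> m /memN_msupp_eq0 ->; rewrite mul0r.
Qed.

Lemma diag_meval n (p : {mpoly K[n]}) (z : 'I_n -> I -> K) :
  (map_mpoly diag p).@[fun k => cl (z k)] = cl (fun i => p.@[fun k => z k i]).
Proof.
apply: cl_meval => [m|i m]; first by rewrite mcoeff_map_mpoly.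
by rewrite !mcoeff_msupp mcoeff_map_mpoly fmorph_eq0.
Qed.

End Ultrapower.

Arguments cl {I} U {K} f.
Arguments diag {I} U {K} x.

(** * Extension to transcendental elements *)

Section DualMap.
Variables (F F' : fieldType) (f : {rmorphism F -> F'}).

Definition dual_map (z : dual F) : dual F' := Dual (f (re z)) (f (eps z)).
Lemma dual_map_is_zmod_morphism : zmod_morphism dual_map.
Proof. by move=> z w; apply: dual_eq; rewrite /dual_map !(raddfB, rmorphB). Qed.
Lemma dual_map_is_monoid_morphism : monoid_morphism dual_map.
Proof.
split=> [|z w]; apply: dual_eq; rewrite /dual_map /re /eps /=.
- by rewrite rmorph1.
- by rewrite rmorph0.
- by rewrite rmorphM.
- by rewrite rmorphD !rmorphM.
Qed.
HB.instance Definition _ := GRing.isZmodMorphism.Build (dual F) (dual F') dual_map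
  dual_map_is_zmod_morphism.
HB.instance Definition _ := GRing.isMonoidMorphism.Build (dual F) (dual F') dual_map
  dual_map_is_monoid_morphism.

Lemma dual_map_eq0 z : (dual_map z == 0) = (z == 0).
Proof.
apply/eqP/eqP => [H|->]; last by rewrite rmorph0.
have := congr1 re H; have := congr1 eps H; rewrite /dual_map {1}/eps {1}/re /=.
rewrite !raddf0 => /eqP + /eqP; rewrite !fmorph_eq0 => /eqP e0 /eqP r0.
by apply: dual_eq; rewrite ?r0 ?e0 !raddf0.
Qed.

(** Splitting is stated with roots in [G], so it does not depend on the ambient
    field. *)
Lemma splits_upto_image (G : set (dual F)) n :
  (forall m, splits_upto G m) -> splits_upto (dual_map @` G) n.
Proof.
move=> sG q Hq /andP[q1 _].
have /choice[c Hc] : forall i, exists z, G z /\ dual_map z = q`_i.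
  by move=> i; have [z Gz E] := Hq i; exists z.
pose q0 := \poly_(i < size q) c i.
have c0 i : (size q <= i)%N -> c i = 0.
  by move=> iq; apply/eqP; rewrite -dual_map_eq0 (proj2 (Hc i)) nth_default.
have Eq0 i : q0`_i = c i.
  by rewrite coef_poly; case: ltnP => // /c0.
have Eq : q = map_poly dual_map q0.
  apply/polyP => i; rewrite coef_map_id0 ?rmorph0 // Eq0.
  by have [_ ->] := Hc i.
have Hq0 : pover G q0 by move=> i; rewrite Eq0; have [] := Hc i.
have sq : size q0 = size q.
  apply: size_poly_eq; rewrite -dual_map_eq0 (proj2 (Hc _)) -lead_coefE.
  by rewrite lead_coef_eq0 -size_poly_gt0 (ltn_trans _ q1).
have [|A GA /rootP qA] := sG (size q).+1 q0 Hq0; first by rewrite sq q1 ltnSn.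
exists (dual_map A); first by exists A.
by apply/rootP; rewrite Eq horner_map /= qA rmorph0.
Qed.

End DualMap.

Section UltraValuation.
Variables (I : Type) (U : ultra I) (F : fieldType) (V : set F).
Hypothesis VV : val_ring V.

Definition uval : set (upow U F) := [set y | ae U (fun i => V (rep y i))].

Lemma uvalP f : uval (cl U f) <-> ae U (fun i => V (f i)).
Proof.
rewrite /uval /=; split=> H; apply: ae_mono (ae_and H (clK U f)) _ => i [].
  by move=> + <-.
by move=> + ->.
Qed.

Lemma uval_val_ring : val_ring uval.
Proof.
split.
- by rewrite -[1]/(cl U (fun _ => 1)); apply/uvalP/aeT => i; exact: vr1.
- elim/clW => f; elim/clW => g /uvalP Hf /uvalP Hg; rewrite clN clD; apply/uvalP.
  by apply: ae_mono (ae_and Hf Hg) _ => i []; exact: vrB.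
- elim/clW => f; elim/clW => g /uvalP Hf /uvalP Hg; rewrite clM; apply/uvalP.
  by apply: ae_mono (ae_and Hf Hg) _ => i []; exact: vrM.
- elim/clW => f; rewrite clV.
  have /ae_or[H|H] : ae U (fun i => V (f i) \/ V (f i)^-1).
    by apply: aeT => i; exact: vr_total.
  + by left; apply/uvalP.
  + by right; apply/uvalP.
- move=> n; have [n0 Vn] := vr_nat VV n.
  have -> : n.+1%:R = diag U n.+1%:R :> upow U F by rewrite rmorph_nat.
  by split; rewrite ?fmorph_eq0 // -fmorphV; apply/uvalP/aeT.
Qed.

Lemma uval_diag x : uval (diag U x) <-> V x.
Proof.
split=> [/uvalP H|Vx]; last by apply/uvalP/aeT.
by have [] := ae_ex H.
Qed.

End UltraValuation.

(** The derivative [x'] must satisfy [x' - eps A] in [(x - re A) V] for all [A] in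
    the graph.  Finitely many of these conditions are satisfied by [eps A] for the
    [A] among them with [re A] nearest to [x].  The ultrapower indexed by the finite
    families satisfies them all simultaneously. *)
Lemma log_der_extend (F : fieldType) (V : set F) (G : set (dual F)) (x : F) :
  val_ring V -> alg_closed F -> log_der V G ->
  exists (F' : fieldType) (f : {rmorphism F -> F'}) (V' : set F') (G' : set (dual F')),
    [/\ val_ring V' /\ alg_closed F', forall y, V' (f y) <-> V y, log_der V' G',
        forall z, G z -> G' (dual_map f z) & exists x', G' (Dual (f x) x')].
Proof.
move=> VV cF G0; have [Gm mG sG] := log_max_exists G0.
have GG : log_der V Gm := proj1 mG.
pose B (s : seq (dual F)) : set (seq (dual F)) := [set t : seq (dual F) | {subset s <= t}].
have [s|s t|U HU] := @ultra_exists _ _ [::] B.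
- by exists s => z.
- exists (s ++ t) => r Hr.
  by split=> z zs; apply: Hr; rewrite mem_cat zs ?orbT.
have /choice[x' Hx'] : forall s : seq (dual F), exists x', forall A, A \in s -> Gm A ->
    vdvd V (x - re A) (x' - eps A).
  move=> s; pose t := [seq A <- s | `[< Gm A >]].
  case Et : t => [|A0 t'].
    exists 0 => A As GA; suff : A \in t by rewrite Et.
    by rewrite mem_filter As andbT; apply/asboolP.
  have [a] := vdvd_closest VV x (re A0) (map re t').
  rewrite -map_cons -Et => /mapP[A At ->] HA.
  move: At; rewrite mem_filter => /andP[/asboolP GA As].
  exists (eps A) => A' A's GA'; rewrite -raddfB.
  have HAA' : vdvd V (x - re A') (x - re A).
    by apply: HA; apply: map_f; rewrite mem_filter A's andbT; apply/asboolP.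
  apply: (vdvd_trans VV _ (ld_bounded GG (ldB GG GA GA'))).
  have -> : re (A - A') = (x - re A') - (x - re A) by rewrite rmorphB /=; ring.
  by apply: (vdvdB VV) => //; exact: vdvd_refl.
pose V' := @uval _ U _ V; have VV' := uval_val_ring U VV.
pose f : {rmorphism F -> upow U F} := diag U.
pose G1 : set (dual (upow U F)) := dual_map f @` Gm.
have diagV a b : vdvd V a b -> vdvd V' (f a) (f b).
  by move=> [c Vc ->]; exists (f c); [exact/uval_diag|rewrite rmorphM].
have GG1 : log_der V' G1.
  split.
  - by exists 1; [exact: ld1 GG|rewrite rmorph1].
  - move=> _ _ [z Gz <-] [w Gw <-]; exists (z - w); last by rewrite rmorphB.
    exact: (ldB GG).
  - move=> _ _ [z Gz <-] [w Gw <-]; exists (z * w); last by rewrite rmorphM.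
    exact: (ldM GG).
  - by move=> _ [z Gz <-]; apply: diagV; exact: ld_bounded Gz.
have sG1 n : splits_upto G1 n.
  by apply: splits_upto_image => m; exact: (log_max_splits VV mG cF).
pose z0 : dual (upow U F) := Dual (f x) (cl U x').
have bounded A : G1 A -> log_bounded V' (z0 - A).
  move=> [{}A GA <-]; rewrite /log_bounded rmorphB raddfB /=.
  rewrite [re z0]/(f x) [eps z0]/(cl U x') /re /eps /= -/(re A) -/(eps A).
  have HA : ae U (fun s => A \in s).
    by apply: ae_mono (HU [:: A]) _ => s; apply; exact: mem_head.
  have [c Hc] : exists c, ae U (fun s => V (c s) /\ x' s - eps A = c s * (x - re A)).
    apply: (@ae_choice _ U F 0 (fun s y => V y /\ x' s - eps A = y * (x - re A))).
    apply: ae_mono HA _ => s As.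
    by have [c Vc Ec] := Hx' s A As GA; exists c.
  exists (cl U c); first by apply/uvalP; apply: ae_mono Hc _ => s [].
  rewrite -rmorphB /= /diag clN clD clM; apply/clP.
  by apply: ae_mono Hc _ => s [].
have [|G' [GG' s1 G'z]] := log_der_adjoin GG1 (z := z0).
  by move=> q Hq; apply: (splits_log_bounded VV' GG1 (sG1 (size q).+1) bounded).
exists (upow U F), f, V', G'; split => //.
- by split => //; exact: upow_alg_closed.
- by move=> y; exact: uval_diag.
- by move=> z Gz; apply: s1; exists z => //; exact: sG.
- by exists (cl U x').
Qed.

Lemma log_der_extend_seq (F : fieldType) (V : set F) (G : set (dual F)) (xs : seq F) :
  val_ring V -> alg_closed F -> log_der V G ->
  exists (F' : fieldType) (f : {rmorphism F -> F'}) (V' : set F') (G' : set (dual F')),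
    [/\ val_ring V', forall y, V' (f y) <-> V y, log_der V' G',
        forall z, G z -> G' (dual_map f z) &
        forall x, x \in xs -> exists x', G' (Dual (f x) x')].
Proof.
have [n] := ubnP (size xs); elim: n F V G xs => // n IH F V G [|x xs] /= sx VV cF GG.
  exists F, idfun, V, G; split => // -[a b]; by [].
have [F1 [f1 [V1 [G1 [[VV1 cF1] fV1 GG1 sG1 [x' Gx]]]]]] := log_der_extend x VV cF GG.
have [F2 [f2 [V2 [G2 [VV2 fV2 GG2 sG2 Gxs]]]]] :=
  IH F1 V1 G1 (map f1 xs) (eq_ind_r (fun k => (k < n)%N) sx (size_map f1 xs)) VV1 cF1 GG1.
exists F2, (f2 \o f1 : {rmorphism F -> F2}), V2, G2; split => //.
- by move=> y /=; rewrite fV2.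
- by move=> z Gz; apply: (sG2 (dual_map f1 z)); exact: sG1.
- move=> y; rewrite inE => /orP[/eqP->|ys].
    by exists (f2 x'); exact: (sG2 (Dual (f1 x) x')).
  by have [|y' Gy] := Gxs (f1 y); [exact: map_f|exists y'].
Qed.

(** * Chevalley's construction of valuation rings *)

Section Chevalley.
Variables (F : fieldType) (n : nat) (c : 'I_n -> F).

Record subring (R : set F) : Prop := Subring {
  sr1 : R 1;
  srB : forall x y, R x -> R y -> R (x - y);
  srM : forall x y, R x -> R y -> R (x * y) }.

Definition gen_ideal (R : set F) (y : F) : Prop :=
  exists2 r : 'I_n -> F, forall i, R (r i) & y = \sum_i r i * c i.

Section Ops.
Variable R : set F.
Hypothesis RR : subring R.
Lemma sr0 : R 0. Proof. by rewrite -(subrr 1); apply: srB => //; exact: sr1. Qed.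
Lemma srD x y : R x -> R y -> R (x + y).
Proof.
move=> Rx Ry; rewrite -(opprK y); apply: srB => //; rewrite -sub0r.
by apply: srB => //; exact: sr0.
Qed.
Lemma srX x k : R x -> R (x ^+ k).
Proof. by move=> Rx; elim: k => [|k IH]; rewrite ?exprS; [exact: sr1|exact: srM]. Qed.
Lemma sr_sum (I : Type) (s : seq I) (P : pred I) (f : I -> F) :
  (forall i, P i -> R (f i)) -> R (\sum_(i <- s | P i) f i).
Proof. by move=> H; elim/big_ind: _ => //; [exact: sr0 | exact: srD]. Qed.
Lemma gen_ideal0 : gen_ideal R 0.
Proof.
exists (fun _ => 0); first by move=> _; exact: sr0.
by rewrite big1 // => i _; rewrite mul0r.
Qed.
Lemma gen_idealB x y : gen_ideal R x -> gen_ideal R y -> gen_ideal R (x - y).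
Proof.
move=> [r Rr ->] [s Rs ->]; exists (fun i => r i - s i); first by move=> i; exact: srB.
by rewrite -sumrB; apply: eq_bigr => i _; rewrite mulrBl.
Qed.
Lemma gen_idealD x y : gen_ideal R x -> gen_ideal R y -> gen_ideal R (x + y).
Proof.
move=> Hx Hy; rewrite -(opprK y); apply: gen_idealB => //; rewrite -sub0r.
by apply: gen_idealB => //; exact: gen_ideal0.
Qed.
Lemma gen_idealM x y : R x -> gen_ideal R y -> gen_ideal R (x * y).
Proof.
move=> Rx [r Rr ->]; exists (fun i => x * r i); first by move=> i; exact: srM.
by rewrite mulr_sumr; apply: eq_bigr => i _; rewrite mulrA.
Qed.
Lemma gen_ideal_sum (I : Type) (s : seq I) (P : pred I) (f : I -> F) :
  (forall i, P i -> gen_ideal R (f i)) -> gen_ideal R (\sum_(i <- s | P i) f i).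
Proof. by move=> H; elim/big_ind: _ => //; [exact: gen_ideal0 | exact: gen_idealD]. Qed.
End Ops.

Section Maximal.
Variable R : set F.
Hypotheses (RR : subring R) (R1 : ~ gen_ideal R 1).
Hypothesis Rc : forall i, R (c i).
Hypothesis maxR : forall R', subring R' -> ~ gen_ideal R' 1 -> R `<=` R' -> R' `<=` R.

Lemma gen_ideal_R y : gen_ideal R y -> R y.
Proof. by move=> [r Rr ->]; apply: (sr_sum RR) => i _; exact: srM. Qed.

(** Inverses of powers of [1 - a] can be adjoined without making the ideal trivial:
    such a denominator is congruent to [1] modulo the ideal, so clearing it in an
    expression of [1] would give another one. *)
Lemma maximal_unit a : gen_ideal R a -> R (1 - a)^-1.
Proof.
move=> Ha; pose u := 1 - a.
have Ru : R u by apply: (srB RR); [exact: sr1|exact: gen_ideal_R].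
have u0 : u != 0.
  by apply/eqP => u0; apply: R1; rewrite -(subrK a 1) -/u u0 add0r.
have uX k : gen_ideal R (1 - u ^+ k).
  elim: k => [|k IH]; first by rewrite expr0 subrr; exact: gen_ideal0.
  have -> : 1 - u ^+ k.+1 = u * (1 - u ^+ k) + a by rewrite exprS /u; ring.
  by apply: (gen_idealD RR) => //; exact: gen_idealM.
pose R' := [set y | exists k, R (y * u ^+ k)].
have RR' : subring R'.
  split.
  - by exists 0%N; rewrite expr0 mulr1; exact: sr1.
  - move=> x y [k Hx] [l Hy]; exists (k + l)%N; rewrite exprD.
    have -> : (x - y) * (u ^+ k * u ^+ l)
      = (x * u ^+ k) * u ^+ l - (y * u ^+ l) * u ^+ k by ring.
    by apply: (srB RR); apply: (srM RR) => //; exact: srX.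
  - move=> x y [k Hx] [l Hy]; exists (k + l)%N; rewrite exprD.
    have -> : (x * y) * (u ^+ k * u ^+ l) = (x * u ^+ k) * (y * u ^+ l) by ring.
    exact: (srM RR).
apply: (maxR RR') => [[r R'r E]|y Ry|].
- have [k Hk] := choice R'r; pose K := (\sum_i k i)%N.
  apply: R1; rewrite -(subrK (u ^+ K) 1); apply: (gen_idealD RR (uX K)).
  exists (fun i => r i * u ^+ K).
    move=> i; have iK : (k i <= K)%N by rewrite /K (bigD1 i) //= leq_addr.
    by rewrite -(subnKC iK) exprD mulrA; apply: (srM RR) => //; exact: srX.
  rewrite -[u ^+ K]mul1r {1}E mulr_suml; apply: eq_bigr => i _; ring.
- by exists 0%N; rewrite expr0 mulr1.
- by exists 1%N; rewrite expr1 mulVf //; exact: sr1.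
Qed.

Definition span_poly (g : {poly F}) : Prop := forall j, gen_ideal R g`_j.

Lemma maximal_adjoin x : ~ R x -> exists2 g, span_poly g & g.[x] = 1.
Proof.
move=> nRx; pose R' := [set y | exists2 q : {poly F}, forall j, R q`_j & y = q.[x]].
have RR' : subring R'.
  split.
  - exists 1; last by rewrite hornerC.
    by move=> j; rewrite coef1; case: eqP => _; [exact: sr1|exact: sr0].
  - move=> _ _ [p Hp ->] [q Hq ->]; exists (p - q); last by rewrite !hornerE.
    by move=> j; rewrite coefB; exact: srB.
  - move=> _ _ [p Hp ->] [q Hq ->]; exists (p * q); last by rewrite hornerM.
    by move=> j; rewrite coefM; apply: (sr_sum RR) => i _; exact: srM.
have [[r R'r E]|N] := pselect (gen_ideal R' 1).
  have /choice[q Hq] : forall i, exists q : {poly F}, (forall j, R q`_j) /\ r i = q.[x].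
    by move=> i; have [q Hq Eq] := R'r i; exists q.
  exists (\sum_i c i *: q i).
    move=> j; rewrite coef_sum; apply: (gen_ideal_sum RR) => i _; rewrite coefZ mulrC.
    have [Hj _] := Hq i; apply: (gen_idealM RR) => //.
    exists (fun k => (k == i)%:R); first by move=> k; case: eqP => _; [exact: sr1|exact: sr0].
    rewrite (bigD1 i) //= eqxx mul1r big1 ?addr0 // => k /negPf ->.
    by rewrite mul0r.
  rewrite horner_sum [RHS]E; apply: eq_bigr => i _.
  by rewrite hornerZ -(proj2 (Hq i)) mulrC.
case: nRx; apply: (maxR RR' N).
  move=> y Ry; exists y%:P; last by rewrite hornerC.
  by move=> j; rewrite coefC; case: eqP => // _; exact: sr0.
exists 'X; last by rewrite hornerX.
by move=> j; rewrite coefX; case: eqP => _; [exact: sr1|exact: sr0].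
Qed.

(** The relation for [x^-1], multiplied by a power of [x] and divided by the unit
    [1 - h`_0], expresses the leading power of [x] in [g] by lower ones. *)
Lemma maximal_reduce x g h : x != 0 -> span_poly g -> g.[x] = 1 ->
  span_poly h -> h.[x^-1] = 1 -> (size h <= size g)%N ->
  exists2 g', span_poly g' & g'.[x] = 1 /\ (size g' < size g)%N.
Proof.
move=> x0 Hg gx Hh hx hg.
have g0 : g != 0 by apply: contra_eq_neq gx => ->; rewrite horner0 eq_sym oner_eq0.
have h0 : h != 0 by apply: contra_eq_neq hx => ->; rewrite horner0 eq_sym oner_eq0.
have [N Ng] : exists N, size g = N.+1 by exists (size g).-1; rewrite prednK ?size_poly_gt0.
have [M Mh] : exists M, size h = M.+1 by exists (size h).-1; rewrite prednK ?size_poly_gt0.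
have MN : (M <= N)%N by move: hg; rewrite Ng Mh.
have Ru := maximal_unit (Hh 0%N); have ux : 1 - h`_0 = \sum_(j < M) h`_j.+1 * x^-1 ^+ j.+1.
  by move: hx; rewrite horner_coef Mh big_ord_recl expr0 mulr1 => <-; rewrite addrC addKr.
have u0 : 1 - h`_0 != 0.
  apply: contra_not_neq R1 => /eqP; rewrite subr_eq0 => /eqP ->; exact: Hh.
pose t := g`_N / (1 - h`_0).
pose g' := \poly_(i < N) g`_i + t *: \sum_(j < M) h`_j.+1 *: 'X^(N - j.+1).
exists g'; last split.
- move=> k; rewrite coefD; apply: (gen_idealD RR).
    by rewrite coef_poly; case: ifP => _; [exact: Hg|exact: gen_ideal0].
  rewrite coefZ coef_sum; apply: (gen_idealM RR).
    by apply: (srM RR) => //; apply: gen_ideal_R; exact: Hg.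
  apply: (gen_ideal_sum RR) => j _; rewrite coefZ coefXn mulrC.
  by apply: (gen_idealM RR) => //; case: eqP => _; [exact: sr1|exact: sr0].
- rewrite hornerD hornerZ horner_sum horner_poly -[RHS]gx horner_coef Ng big_ord_recr /=.
  congr (_ + _).
  have -> : \sum_(i < M) (h`_i.+1 *: 'X^(N - i.+1)).[x] = x ^+ N * (1 - h`_0).
    rewrite ux mulr_sumr; apply: eq_bigr => j _; rewrite hornerZ hornerXn mulrCA; congr (_ * _).
    have jN : (j.+1 <= N)%N by exact: leq_trans (ltn_ord j) MN.
    by rewrite -{2}(subnK jN) exprD exprVn mulfK // expf_neq0.
  by rewrite /t mulrCA mulrC divfK.
- rewrite Ng ltnS (leq_trans (size_polyD _ _)) // geq_max size_poly /=.
  apply: (leq_trans (size_scale_leq _ _)); apply: (leq_trans (size_sum _ _ _)).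
  apply/bigmax_leqP => j _; apply: (leq_trans (size_scale_leq _ _)).
  have jN : (j.+1 <= N)%N by exact: leq_trans (ltn_ord j) MN.
  by rewrite size_polyXn -subSn // subSS leq_subr.
Qed.

Lemma maximal_total x : R x \/ R x^-1.
Proof.
have [->|x0] := eqVneq x 0; first by left; exact: sr0.
apply: contrapT => /not_orP[nx nx'].
have [g Hg gx] := maximal_adjoin nx; have [h Hh hx] := maximal_adjoin nx'.
have [k] := ubnP (size g + size h); elim: k g h Hg gx Hh hx => // k IH g h Hg gx Hh hx.
rewrite ltnS => sk; case: (leqP (size h) (size g)) => [hg|/ltnW gh].
  have [g' Hg' [g'x sg']] := maximal_reduce x0 Hg gx Hh hx hg.
  by apply: (IH g' h) => //; apply: leq_trans sk; rewrite ltn_add2r.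
have [||h' Hh' [h'x sh']] := maximal_reduce _ Hh hx Hg _ gh.
- by rewrite invr_eq0.
- by rewrite invrK.
by apply: (IH g h') => //; apply: leq_trans sk; rewrite ltn_add2l.
Qed.

End Maximal.

(** A subring maximal among those in which the [c i] generate a proper ideal is a
    valuation ring: were neither [x] nor [x^-1] in it, each would satisfy a relation
    with value [1], and the two could be shortened against each other forever. *)
Lemma chevalley (R0 : set F) : subring R0 -> (forall i, R0 (c i)) -> ~ gen_ideal R0 1 ->
  (forall k, k.+1%:R != 0 :> F /\ R0 (k.+1%:R^-1)) ->
  exists V, [/\ val_ring V, R0 `<=` V & forall i, V (c i)^-1 -> c i = 0].
Proof.
move=> RR0 R0c R01 R0n; pose P R := subring R /\ ~ gen_ideal R 1.
have [//||R [[RR R1] sR maxR]] := @zorn_finitary _ R0 P.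
  move=> A sA fin.
  have pair x y : A x -> A y -> exists B, [/\ P B, B `<=` A, B x & B y].
    move=> Ax Ay; have [|B [PB BA Bx]] := fin bool (fun b => if b then x else y).
      by case.
    by exists B; split=> //; [exact: (Bx true)|exact: (Bx false)].
  split; first split.
  - exact/sA/(sr1 RR0).
  - by move=> x y Ax Ay; have [B [[RB _] BA Bx By]] := pair x y Ax Ay; apply/BA/(srB RB).
  - by move=> x y Ax Ay; have [B [[RB _] BA Bx By]] := pair x y Ax Ay; apply/BA/(srM RB).
  - by move=> [r Ar E]; have [B [[_ B1] BA Br]] := fin _ r Ar; apply: B1; exists r.
have maxR' R' : subring R' -> ~ gen_ideal R' 1 -> R `<=` R' -> R' `<=` R.
  by move=> ? ?; apply: maxR.
have Rc i : R (c i) by exact: sR.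
exists R; split=> //; first split.
- exact: sr1.
- exact: srB.
- exact: srM.
- exact: maximal_total.
- by move=> k; have [k0 Rk] := R0n k; split=> //; exact: sR.
move=> i Rci; apply: contrapT => /eqP ci; apply: R1.
exists (fun k => if k == i then (c i)^-1 else 0).
  by move=> k; case: ifP => _ //; exact: sr0.
rewrite (bigD1 i) //= eqxx mulVf // big1 ?addr0 // => k /negPf ->.
by rewrite mul0r.
Qed.

End Chevalley.

(** * Euler's identity and first-order Taylor expansion *)

Lemma meval_sum (n : nat) (R : comNzRingType) (v : 'I_n -> R) (I : Type) (r : seq I)
    (P : pred I) (p : I -> {mpoly R[n]}) :
  (\sum_(i <- r | P i) p i).@[v] = \sum_(i <- r | P i) (p i).@[v].
Proof. exact: (raddf_sum (meval v)). Qed.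

Lemma submm n (m : 'X_{1..n}) : (m - m)%MM = 0%MM.
Proof. by apply/mnmP => i; rewrite mnmBE subnn mnm0E. Qed.

Section MPolyAux.
Variables (n : nat) (K : fieldType).

Lemma mpoly_ring_ind (P : {mpoly K[n]} -> Prop) :
  (forall c, P c%:MP) -> (forall i, P 'X_i) ->
  (forall p q, P p -> P q -> P (p + q)) -> (forall p q, P p -> P q -> P (p * q)) ->
  forall p, P p.
Proof.
move=> PC PX PD PM; elim/mpolyind => [|c m p _ _ Pp]; first by rewrite -(mpolyC0 n K).
apply: (PD) => //; rewrite -mul_mpolyC; apply: (PM) => //; rewrite mpolyXE_id.
have P1 : P 1 by rewrite -mpolyC1.
elim/big_ind: _ => // i _; elim: (m i) => [|k IH]; first by rewrite expr0.
by rewrite exprS; apply: PM.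
Qed.

Lemma euler d (p : {mpoly K[n]}) : p \is d.-homog ->
  \sum_k 'X_k * p^`M(k) = d%:R *: p.
Proof.
move=> hp; rewrite {1 2}(mpolyE p) scaler_sumr.
under eq_bigr => k _ do rewrite raddf_sum mulr_sumr.
rewrite exchange_big /= big_seq [RHS]big_seq; apply: eq_bigr => m mp.
have dm : (\sum_i m i)%N = d by rewrite -mdegE; exact: (dhomog_mf hp mp).
rewrite scalerA mulrC -scalerA -dm natr_sum scaler_suml scaler_sumr.
apply: eq_bigr => k _; rewrite mderivZ mderivX.
have [mk|mk] := posnP (m k); first by rewrite mk !(scale0r, scaler0, mulr0).
by rewrite -!scalerAr -mpolyXD addmC submK // lep1mP -lt0n.
Qed.

Variables (L : fieldType) (f : {rmorphism K -> L}).

Lemma meval_map (p : {mpoly K[n]}) (v : 'I_n -> K) :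
  (map_mpoly f p).@[fun i => f (v i)] = f p.@[v].
Proof.
elim/mpoly_ring_ind: p => [c|i|p q Hp Hq|p q Hp Hq].
- by rewrite map_mpolyC !mevalC.
- by rewrite map_mpolyX !mevalXU.
- by rewrite rmorphD !mevalD Hp Hq rmorphD.
- by rewrite rmorphM !mevalM Hp Hq rmorphM.
Qed.

Lemma mderiv_map (p : {mpoly K[n]}) k : (map_mpoly f p)^`M(k) = map_mpoly f p^`M(k).
Proof.
apply/mpolyP => m; rewrite mcoeff_map_mpoly !mcoeff_deriv mcoeff_map_mpoly.
by rewrite raddfMn.
Qed.

End MPolyAux.

Section Taylor.
Variables (n : nat) (F : fieldType).

Definition dual_const (x : F) : dual F := Dual x 0.
Lemma dual_const_is_zmod_morphism : zmod_morphism dual_const.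
Proof. by move=> x y; apply: dual_eq => //; rewrite [RHS]subr0. Qed.
Lemma dual_const_is_monoid_morphism : monoid_morphism dual_const.
Proof. by split=> // x y; apply: dual_eq => //; rewrite epsM mul0r mulr0 addr0. Qed.
HB.instance Definition _ := GRing.isZmodMorphism.Build F (dual F) dual_const
  dual_const_is_zmod_morphism.
HB.instance Definition _ := GRing.isMonoidMorphism.Build F (dual F) dual_const
  dual_const_is_monoid_morphism.

Lemma re_meval_const (p : {mpoly F[n]}) (Z : 'I_n -> dual F) :
  re (map_mpoly dual_const p).@[Z] = p.@[fun i => re (Z i)].
Proof.
elim/mpoly_ring_ind: p => [c|i|p q Hp Hq|p q Hp Hq].
- by rewrite map_mpolyC !mevalC.
- by rewrite map_mpolyX !mevalXU.
- by rewrite [map_mpoly _ _]rmorphD (mevalD Z) [LHS]raddfD mevalD; congr (_ + _).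
- by rewrite [map_mpoly _ _]rmorphM (mevalM Z) [LHS]rmorphM mevalM; congr (_ * _).
Qed.

Lemma eps_meval_const (p : {mpoly F[n]}) (Z : 'I_n -> dual F) :
  eps (map_mpoly dual_const p).@[Z] =
  \sum_k p^`M(k).@[fun i => re (Z i)] * eps (Z k).
Proof.
elim/mpoly_ring_ind: p => [c|i|p q Hp Hq|p q Hp Hq].
- rewrite map_mpolyC !mevalC big1 // => k _.
  by rewrite mderivC meval0 mul0r.
- rewrite map_mpolyX !mevalXU (bigD1 i) //= big1 ?addr0 => [|k ki].
    by rewrite mderivX mnm1E eqxx scale1r submm mpolyX0 meval1 mul1r.
  by rewrite mderivX mnm1E eq_sym (negPf ki) scale0r meval0 mul0r.
- rewrite [map_mpoly _ _]rmorphD (mevalD Z) [LHS]raddfD.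
  have := congr2 +%R Hp Hq; rewrite -big_split => H; apply: (etrans H).
  by apply: eq_bigr => k _; rewrite mderivD mevalD mulrDl.
- rewrite [map_mpoly _ _]rmorphM (mevalM Z) epsM.
  have H1 := congr2 *%R Hp (re_meval_const q Z).
  have H2 := congr2 *%R (re_meval_const p Z) Hq.
  apply: (etrans (congr2 +%R H1 H2)).
  rewrite mulr_suml mulr_sumr -big_split; apply: eq_bigr => k _ /=.
  by rewrite mderivM mevalD !mevalM mulrDl mulrAC mulrA.
Qed.

End Taylor.

(** * Lifting a derivation along a specialization *)

Definition max_ideal (F : fieldType) (V : set F) (x : F) : Prop :=
  V x /\ (V x^-1 -> x = 0).

Section MaxIdeal.
Variables (F : fieldType) (V : set F).
Hypothesis VV : val_ring V.

Lemma max_idealM x y : V x -> max_ideal V y -> max_ideal V (x * y).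
Proof.
move=> Vx [Vy my]; split=> [|Vxy]; first exact: vrM.
have [->|x0] := eqVneq x 0; first by rewrite mul0r.
have E : y^-1 = x * (x * y)^-1 by rewrite invfM mulVKf.
by rewrite my ?mulr0 // E; exact: vrM.
Qed.

Lemma max_idealD x y : max_ideal V x -> max_ideal V y -> max_ideal V (x + y).
Proof.
move=> mx my; have [Vx _] := mx; have [Vy _] := my.
case: (vdvd_total VV x y) => -[c Vc E].
  have -> : x + y = (1 + c) * x by rewrite E; ring.
  by apply: max_idealM => //; apply: (vrD VV) => //; exact: vr1.
have -> : x + y = (1 + c) * y by rewrite E; ring.
by apply: max_idealM => //; apply: (vrD VV) => //; exact: vr1.
Qed.

Lemma max_ideal0 : max_ideal V 0. Proof. by split=> //; exact: vr0. Qed.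

Lemma max_ideal_sum (I : Type) (s : seq I) (P : pred I) (f : I -> F) :
  (forall i, P i -> max_ideal V (f i)) -> max_ideal V (\sum_(i <- s | P i) f i).
Proof. by move=> H; elim/big_ind: _ => //; [exact: max_ideal0|exact: max_idealD]. Qed.

Lemma max_ideal_dvd x y : max_ideal V x -> vdvd V x y -> max_ideal V y.
Proof. by move=> mx [c Vc ->]; exact: max_idealM. Qed.

End MaxIdeal.

(** The sets of points of [S] at which a polynomial [p] with [p(w) != 0] does not
    vanish are nonempty, since [w] is in the closure of [S], and closed under
    intersections, by taking products of polynomials. *)
Lemma generic_specialization (E : fieldType) (m : nat) (S : set ('I_m -> E))
    (w : 'I_m -> E) :
  (forall p : {mpoly E[m]}, (forall s, S s -> p.@[s] = 0) -> p.@[w] = 0) ->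
  exists U : ultra ('I_m -> E), ae U S /\
    forall p : {mpoly E[m]}, p.@[w] != 0 -> ae U (fun s => p.@[s] != 0).
Proof.
move=> clw; pose J := {p : {mpoly E[m]} | p.@[w] != 0}.
have w1 : (1 : {mpoly E[m]}).@[w] != 0 by rewrite meval1 oner_eq0.
have [p|p q|U HU] := @ultra_exists ('I_m -> E) J (exist _ 1 w1)
    (fun p => [set s | S s /\ (sval p).@[s] != 0]).
- apply: contrapT => N; case: p N => p pw /= N; case/eqP: pw; apply: clw => s Ss.
  by apply: contrapT => /eqP ps; apply: N; exists s.
- have pqw : (sval p * sval q).@[w] != 0.
    by rewrite mevalM mulf_neq0 //; [exact: (svalP p)|exact: (svalP q)].
  exists (exist _ (sval p * sval q) pqw) => s /= [Ss].
  by rewrite mevalM mulf_eq0 negb_or => /andP[].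
exists U; split; first by apply: ae_mono (HU (exist _ 1 w1)) _ => s [].
by move=> p pw; apply: ae_mono (HU (exist _ p pw)) _ => s [].
Qed.

Record derivation (E : fieldType) (D : E -> E) : Prop := Derivation {
  derB : forall x y, D (x - y) = D x - D y;
  derM : forall x y, D (x * y) = D x * y + x * D y }.

Section DerivationTheory.
Variables (E : fieldType) (D : E -> E).
Hypothesis DD : derivation D.
Lemma der0 : D 0 = 0. Proof. by have := derB DD 0 0; rewrite !subrr. Qed.
Lemma derN x : D (- x) = - D x. Proof. by rewrite -sub0r (derB DD) der0 sub0r. Qed.
Lemma derD x y : D (x + y) = D x + D y.
Proof. by rewrite -{1}(opprK y) (derB DD) derN opprK. Qed.
Lemma der1 : D 1 = 0.
Proof.
have := derM DD 1 1; rewrite !mulr1 mul1r => E1.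
by apply: (addrI (D 1)); rewrite addr0 -E1.
Qed.
End DerivationTheory.

Lemma vdvd_trivial (F : fieldType) (x y : F) : x != 0 -> vdvd setT x y.
Proof. by move=> x0; exists (y / x) => //; rewrite divfK. Qed.

Section Specialization.
Variables (E : fieldType) (D : E -> E) (m : nat) (S : set ('I_m -> E)) (w : 'I_m -> E).
Hypotheses (cE : alg_closed E) (charE : forall k, k.+1%:R != 0 :> E)
  (DD : derivation D)
  (clw : forall p : {mpoly E[m]}, (forall s, S s -> p.@[s] = 0) -> p.@[w] = 0).

(** The identity family of points of [S] is a point of [S] over an ultrapower of [E],
    and [w] is a specialization of it over [E].  This makes the differences of their
    coordinates generate a proper ideal, so a valuation ring containing [E] has them
    in its maximal ideal.  On [E] itself the logarithmic derivatives of [D] are in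
    [E], hence bounded, and [D] extends to the coordinates of the point. *)
Lemma lift_derivation : exists (U : ultra ('I_m -> E)) (F : fieldType)
    (f : {rmorphism upow U E -> F}) (V : set F) (G : set (dual F)) (Z : 'I_m -> dual F),
  [/\ ae U S, val_ring V, log_der V G, forall x, V (f (diag U x)) &
   [/\ forall x, G (Dual (f (diag U x)) (f (diag U (D x)))), forall k, G (Z k),
    forall k, re (Z k) = f (cl U (fun s => s k)) &
    forall k, max_ideal V (re (Z k) - f (diag U (w k)))]].
Proof.
have [U [US Up]] := generic_specialization clw.
pose eta (k : 'I_m) : upow U E := cl U (fun s => s k).
pose ev (p : {mpoly E[m]}) := (map_mpoly (diag U) p).@[eta].
have evE p : ev p = cl U (fun s => p.@[s]) by exact: (diag_meval U p (fun k s => s k)).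
have ev_w p : ev p = 0 -> p.@[w] = 0.
  rewrite evE => /cl0P H; apply: contrapT => /eqP /Up H'.
  by apply: (@ae_false _ U); apply: ae_mono (ae_and H H') _ => s [-> /eqP].
have evB p q : ev (p - q) = ev p - ev q by rewrite /ev rmorphB mevalB.
have evM p q : ev (p * q) = ev p * ev q by rewrite /ev rmorphM mevalM.
have evC x : ev x%:MP = diag U x by rewrite /ev map_mpolyC mevalC.
have evX k : ev 'X_k = eta k by rewrite /ev map_mpolyX mevalXU.
pose R0 := range ev.
have RR0 : subring R0.
  split.
  - by exists 1 => //; rewrite -mpolyC1 evC rmorph1.
  - by move=> _ _ [p _ <-] [q _ <-]; exists (p - q).
  - by move=> _ _ [p _ <-] [q _ <-]; exists (p * q).
pose c k := eta k - diag U (w k).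
have evXC k : ev ('X_k - (w k)%:MP) = c k by rewrite evB evX evC.
have R0E x : R0 (diag U x) by exists x%:MP.
have [k||k|V [VV sV cV]] := @chevalley _ _ c R0 RR0.
- by exists ('X_k - (w k)%:MP).
- move=> [r Hr E1].
  have /choice[p Hp] : forall k, exists p, ev p = r k.
    by move=> k; have [p _ Ep] := Hr k; exists p.
  pose q := 1 - \sum_k p k * ('X_k - (w k)%:MP).
  have qw : q.@[w] = 1.
    rewrite mevalB meval1 meval_sum big1 ?subr0 // => k _.
    by rewrite mevalM mevalB mevalXU mevalC subrr mulr0.
  have /eqP := oner_neq0 E; apply; rewrite -qw; apply: ev_w.
  rewrite evB -mpolyC1 evC rmorph1 [X in X - _]E1 /ev [map_mpoly _ _]rmorph_sum meval_sum.
  rewrite -sumrB big1 // => k _; apply/eqP; rewrite subr_eq0 -/(ev _) evM evXC.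
  by rewrite Hp.
- split; first by rewrite -(rmorph_nat (diag U)) fmorph_eq0.
  by rewrite -(rmorph_nat (diag U)) -fmorphV; exact: R0E.
have VE x : V (diag U x) by exact: sV.
pose G0 : set (dual (upow U E)) :=
  [set z | exists x, z = Dual (diag U x) (diag U (D x))].
have GG0 : log_der V G0.
  split.
  - by exists 1; apply: dual_eq; rewrite ?reE ?epsE ?(der1 DD) ?rmorph1 ?rmorph0.
  - move=> _ _ [x ->] [y ->]; exists (x - y); apply: dual_eq.
      by rewrite rmorphB /= !reE rmorphB.
    by rewrite raddfB /= !epsE -rmorphB (derB DD).
  - move=> _ _ [x ->] [y ->]; exists (x * y); apply: dual_eq.
      by rewrite rmorphM /= !reE rmorphM.
    by rewrite epsM !epsE !reE (derM DD) rmorphD !rmorphM.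
  - move=> _ [x ->]; rewrite /log_bounded reE epsE.
    have [->|x0] := eqVneq x 0; first by rewrite (der0 DD) rmorph0; exact: (vdvd0 VV).
    by exists (diag U (D x / x)) => //; rewrite -rmorphM divfK.
have [F [f [V' [G [VV' fV GG sG Gx]]]]] :=
  log_der_extend_seq [seq eta k | k : 'I_m] VV (upow_alg_closed cE) GG0.
have /choice[z Hz] : forall k, exists z, G z /\ re z = f (eta k).
  move=> k; have [|x' Gx'] := Gx (eta k); first by apply: map_f; rewrite mem_enum.
  by exists (Dual (f (eta k)) x').
exists U, F, f, V', G, z; split=> //; first by move=> x; rewrite fV.
split=> [x|k|k|k].
- by apply: (sG (Dual (diag U x) (diag U (D x)))); exists x.
- by have [] := Hz k.
- by have [_ ->] := Hz k.
- have [_ ->] := Hz k; rewrite -rmorphB -/(c k); split.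
    by rewrite fV; apply: sV; exists ('X_k - (w k)%:MP).
  by rewrite -fmorphV fV => /cV ->; rewrite rmorph0.
Qed.

End Specialization.

(** * The contact form on the closure of the conormal cone *)

(** The first half of the coordinates is a zero of the equations [g], the second
    half a linear form that is a combination of their gradients there. *)
Definition conormal_cone (K E : fieldType) (f : {rmorphism K -> E}) (n s : nat)
    (g : 'I_s -> {mpoly K[n]}) : set ('I_(n + n) -> E) :=
  [set z | (forall i, (map_mpoly f (g i)).@[fun k => z (lshift n k)] = 0) /\
    exists l : 'I_s -> E, forall k, z (rshift n k) =
      \sum_i l i * (map_mpoly f (g i)^`M(k)).@[fun k => z (lshift n k)]].

(** Euler's identity for the homogeneous equations. *)
Lemma conormal_cone_incident (K E : fieldType) (f : {rmorphism K -> E}) (n s : nat)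
    (g : 'I_s -> {mpoly K[n]}) z :
  (forall i, exists d : nat, g i \is d.-homog) -> conormal_cone f g z ->
  \sum_k z (lshift n k) * z (rshift n k) = 0.
Proof.
move=> hg [gz [l Hl]].
under eq_bigr => k _ do rewrite Hl mulr_sumr.
rewrite exchange_big big1 // => i _; have [d /euler Ed] := hg i.
have := congr1 (fun p => (map_mpoly f p).@[fun k => z (lshift n k)]) Ed.
rewrite map_mpolyZ mevalZ gz mulr0 [map_mpoly _ _]rmorph_sum meval_sum => E0.
apply: (etrans _ (etrans (congr1 ( *%R (l i)) E0) (mulr0 _))).
rewrite mulr_sumr; apply: eq_bigr => k _ /=.
by rewrite [map_mpoly _ (_ * _)]rmorphM mevalM /= map_mpolyX mevalXU mulrCA.
Qed.

Lemma log_der_meval (F : fieldType) (V : set F) (G : set (dual F)) n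
    (p : {mpoly dual F[n]}) (z : 'I_n -> dual F) :
  log_der V G -> (forall m, G p@_m) -> (forall k, G (z k)) -> G p.@[z].
Proof.
move=> GG Gp Gz; rewrite mevalE; apply: (ld_sum GG) => m _; apply: (ldM GG) => //.
elim/big_ind: _ => [|x y|k _]; [exact: ld1 GG|exact: (ldM GG)|].
by elim: (m k) => [|e IH]; rewrite ?exprS; [exact: ld1 GG|exact: (ldM GG)].
Qed.

(** For a point [(u, a)] of the cone over a larger field, [sum_k a_k D(u_k)] is a
    combination of the derivatives of the [g_i(u) = 0], and [sum_k u_k a_k = 0];
    differentiating the latter gives [sum_k u_k D(a_k) = 0].  Modulo the maximal
    ideal, [u], [a] and [D(a)] are congruent to the data at [w], so the sum for [w]
    is an element of [E] in the maximal ideal of a valuation ring containing [E]. *)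
Theorem conormal_closure_isotropic (K E : fieldType) (f : {rmorphism K -> E})
    (n s : nat) (g : 'I_s -> {mpoly K[n]}) (D : E -> E) (w : 'I_(n + n) -> E) :
  alg_closed E -> (forall k, k.+1%:R != 0 :> E) -> derivation D ->
  (forall c, D (f c) = 0) -> (forall i, exists d : nat, g i \is d.-homog) ->
  (forall p : {mpoly E[n + n]},
     (forall z, conormal_cone f g z -> p.@[z] = 0) -> p.@[w] = 0) ->
  \sum_k w (lshift n k) * D (w (rshift n k)) = 0.
Proof.
move=> cE charE DD Df hg clw.
have [U [F [h [V [G [Z [US VV GG VE [GE GZ reZ Zw]]]]]]]] :=
  lift_derivation cE charE DD clw.
pose u k := re (Z (lshift n k)); pose a k := re (Z (rshift n k)).
pose gF i := map_mpoly h (map_mpoly (diag U) (map_mpoly f (g i))).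
have evu (p : {mpoly E[n]}) : (map_mpoly h (map_mpoly (diag U) p)).@[u]
    = h (cl U (fun z => p.@[fun k => z (lshift n k)])).
  have -> : (map_mpoly h (map_mpoly (diag U) p)).@[u] =
      (map_mpoly h (map_mpoly (diag U) p)).@[fun k => h (cl U (fun z => z (lshift n k)))].
    by apply: meval_eq => k; rewrite /u reZ.
  by rewrite meval_map (diag_meval U p (fun k z => z (lshift n k))).
have gu i : (gF i).@[u] = 0.
  rewrite evu (_ : cl U _ = 0) ?rmorph0 //; apply/cl0P.
  by apply: ae_mono US _ => z [].
have [l Hl] : exists l : ('I_(n + n) -> E) -> 'I_s -> E, ae U (fun z => forall k,
    z (rshift n k) = \sum_i l z i * (map_mpoly f (g i)^`M(k)).@[fun k => z (lshift n k)]).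
  apply: (@ae_choice _ U _ (fun _ => 0) (fun z (lz : 'I_s -> E) => forall k,
    z (rshift n k) = \sum_i lz i * (map_mpoly f (g i)^`M(k)).@[fun k => z (lshift n k)])).
  by apply: ae_mono US _ => z [].
have aE k : a k = \sum_i h (cl U (fun z => l z i)) * (gF i)^`M(k).@[u].
  rewrite /a reZ; have -> : cl U (fun z => z (rshift n k)) = cl U (fun z =>
      \sum_i l z i * (map_mpoly f (g i)^`M(k)).@[fun k => z (lshift n k)]).
    by apply/clP; apply: ae_mono Hl _ => z.
  rewrite -(cl_sum U) rmorph_sum; apply: eq_bigr => i _.
  by rewrite -clM rmorphM /gF !mderiv_map evu.
have ua : \sum_k u k * a k = 0.
  under eq_bigr => k _ do rewrite /u /a !reZ -rmorphM clM.
  rewrite -rmorph_sum cl_sum (_ : cl U _ = 0) ?rmorph0 //; apply/cl0P.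
  by apply: ae_mono US _ => z; exact: conormal_cone_incident.
have tangent i : \sum_k (gF i)^`M(k).@[u] * eps (Z (lshift n k)) = 0.
  rewrite -(eps_meval_const (gF i) (fun k => Z (lshift n k))).
  rewrite (@ld_re0 _ _ _ GG _ _ (etrans (re_meval_const _ _) (gu i))) ?raddf0 //.
  apply: (log_der_meval GG) => // m.
  by have := GE (f (g i)@_m); rewrite Df !rmorph0 !mcoeff_map_mpoly.
have adu : \sum_k a k * eps (Z (lshift n k)) = 0.
  under eq_bigr => k _ do rewrite aE mulr_suml.
  rewrite exchange_big big1 // => i _.
  by under eq_bigr => k _ do rewrite -mulrA; rewrite -mulr_sumr tangent mulr0.
have uda : \sum_k u k * eps (Z (rshift n k)) = 0.
  have G0 : G (\sum_k Z (lshift n k) * Z (rshift n k)).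
    by apply: (ld_sum GG) => k _; apply: (ldM GG).
  have /(ld_re0 GG G0)/(congr1 (@eps F)) : re (\sum_k Z (lshift n k) * Z (rshift n k)) = 0.
    by apply: (etrans _ ua); rewrite rmorph_sum; apply: eq_bigr => k _; rewrite rmorphM.
  rewrite [LHS]raddf_sum [RHS]raddf0 /=; under eq_bigr => k _ do rewrite epsM.
  rewrite big_split /=; under eq_bigr => k _ do rewrite mulrC.
  by rewrite adu add0r.
pose e x := h (diag U x).
have H : max_ideal V (e (\sum_k w (lshift n k) * D (w (rshift n k)))).
  have -> : e (\sum_k w (lshift n k) * D (w (rshift n k))) =
      \sum_k (e (w (lshift n k)) * e (D (w (rshift n k))) - u k * eps (Z (rshift n k))).
    by rewrite sumrB uda subr0 /e !rmorph_sum; apply: eq_bigr => k _; rewrite /= !rmorphM.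
  apply: (max_ideal_sum VV) => k _.
  have -> : e (w (lshift n k)) * e (D (w (rshift n k))) - u k * eps (Z (rshift n k)) =
    - e (D (w (rshift n k))) * (u k - e (w (lshift n k))) +
    - u k * (eps (Z (rshift n k)) - e (D (w (rshift n k)))) by ring.
  apply: (max_idealD VV); apply: (max_idealM VV).
  - by apply: (vrN VV); exact: VE.
  - exact: Zw.
  - apply: (vrN VV); rewrite -(subrK (e (w (lshift n k))) (u k)).
    by apply: (vrD VV); [have [] := Zw (lshift n k)|exact: VE].
  - apply: (max_ideal_dvd VV (Zw (rshift n k))).
    have := ld_bounded GG (ldB GG (GZ (rshift n k)) (GE (w (rshift n k)))).
    by rewrite /log_bounded rmorphB raddfB /= reE epsE.
have [_ He] := H; apply/eqP; rewrite -(fmorph_eq0 (diag U)) -(fmorph_eq0 h).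
by apply/eqP/He; rewrite /e -!fmorphV; exact: VE.
Qed.

(** * Derivations and algebraic independence *)

Lemma val_ring_trivial (F : fieldType) :
  (forall k, k.+1%:R != 0 :> F) -> val_ring [set: F].
Proof. by move=> charF; split=> // x; left. Qed.

(** When the valuation ring is the whole field, every element can be adjoined to the
    graph of a derivation, with derivative zero if it is transcendental; so a maximal
    graph is everywhere defined. *)
Lemma derivation_extends (E : fieldType) (G0 : set (dual E)) :
  alg_closed E -> (forall k, k.+1%:R != 0 :> E) -> log_der setT G0 ->
  exists D, derivation D /\ forall z, G0 z -> eps z = D (re z).
Proof.
move=> cE charE H0; have VV := val_ring_trivial charE.
have [G mG sG] := log_max_exists H0; have GG := proj1 mG.
have /choice[D HD] : forall x, exists x', G (Dual x x').
  move=> x; apply: contrapT => N.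
  have bounded A : G A -> log_bounded setT (Dual x 0 - A).
    move=> GA; apply: vdvd_trivial; rewrite rmorphB /= reE subr_eq0.
    by apply/eqP => xA; apply: N; exists (eps A); rewrite xA; case: A GA {xA}.
  have [|G1 [H1 s1 G1x]] := log_der_adjoin GG (z := Dual x 0).
    move=> q Hq.
    exact: (splits_log_bounded VV GG (log_max_splits VV mG cE (n := (size q).+1)) bounded).
  by apply: N; exists 0; exact: (proj2 mG _ H1 s1).
have DE z : G z -> eps z = D (re z).
  move=> Gz; have := ld_re0 GG (ldB GG Gz (HD (re z))).
  rewrite rmorphB /= reE subrr => /(_ erefl)/(congr1 (@eps E)).
  by rewrite raddfB raddf0 /= epsE => /eqP; rewrite subr_eq0 => /eqP.
exists D; split; last by move=> z /sG; exact: DE.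
split=> x y.
- have := DE _ (ldB GG (HD x) (HD y)).
  by rewrite raddfB rmorphB /= !epsE !reE.
- have := DE _ (ldM GG (HD x) (HD y)).
  by rewrite epsM rmorphM /= !epsE !reE.
Qed.

HB.lock Definition ev (K E : fieldType) (f : {rmorphism K -> E}) n
  (v : 'I_n -> E) (p : {mpoly K[n]}) : E := (map_mpoly f p).@[v].

Section Transcendence.
Variables (K E : fieldType) (f : {rmorphism K -> E}).
Local Notation ev := (ev f).

Lemma evE n (v : 'I_n -> E) p : ev v p = (map_mpoly f p).@[v].
Proof. by rewrite ev.unlock. Qed.
Lemma ev0 n (v : 'I_n -> E) : ev v 0 = 0.
Proof. by rewrite evE rmorph0 meval0. Qed.
Lemma evB n (v : 'I_n -> E) p q : ev v (p - q) = ev v p - ev v q.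
Proof. by rewrite !evE rmorphB mevalB. Qed.
Lemma evD n (v : 'I_n -> E) p q : ev v (p + q) = ev v p + ev v q.
Proof. by rewrite !evE rmorphD mevalD. Qed.
Lemma evM n (v : 'I_n -> E) p q : ev v (p * q) = ev v p * ev v q.
Proof. by rewrite !evE rmorphM mevalM. Qed.
Lemma evC n (v : 'I_n -> E) c : ev v c%:MP = f c.
Proof. by rewrite evE map_mpolyC mevalC. Qed.
Lemma ev1 n (v : 'I_n -> E) : ev v 1 = 1.
Proof. by rewrite -mpolyC1 evC rmorph1. Qed.
Lemma evX n (v : 'I_n -> E) k : ev v 'X_k = v k.
Proof. by rewrite evE map_mpolyX mevalXU. Qed.

Definition const_der (D : E -> E) : Prop := derivation D /\ forall c, D (f c) = 0.

Lemma ev_der D n (v : 'I_n -> E) p : const_der D ->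
  D (ev v p) = \sum_k ev v p^`M(k) * D (v k).
Proof.
move=> [DD Df]; elim/mpoly_ring_ind: p => [c|i|p q Hp Hq|p q Hp Hq].
- rewrite evC Df big1 // => k _; rewrite mderivC.
  by rewrite ev0 mul0r.
- rewrite evX (bigD1 i) //= big1 ?addr0 => [|k ki].
    by rewrite mderivX mnm1E eqxx scale1r submm mpolyX0 ev1 mul1r.
  rewrite mderivX mnm1E eq_sym (negPf ki) scale0r.
  by rewrite ev0 mul0r.
- rewrite evD (derD DD) Hp Hq -big_split; apply: eq_bigr => k _ /=.
  by rewrite mderivD evD mulrDl.
- rewrite evM (derM DD) Hp Hq mulr_suml mulr_sumr -big_split.
  apply: eq_bigr => k _ /=; rewrite mderivM evD !evM mulrDl.
  by rewrite [_ * _ * ev v q]mulrAC [ev v p * (_ * _)]mulrA.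
Qed.

Definition alg_indep n (v : 'I_n -> E) : Prop := forall p, ev v p = 0 -> p = 0.

Hypotheses (cE : alg_closed E) (charE : forall k, k.+1%:R != 0 :> E).

(** The partial derivatives of polynomials in [v] are well defined because [v] is
    algebraically independent, and extend to the whole field. *)
Lemma alg_indep_dual_ders n (v : 'I_n -> E) : alg_indep v ->
  exists D : 'I_n -> E -> E, forall a, const_der (D a) /\ forall b, D a (v b) = (a == b)%:R.
Proof.
move=> iv.
suff H a : exists D, const_der D /\ forall b, D (v b) = (a == b)%:R.
  have /choice[D HD] := H.
  by exists D.
pose G0 : set (dual E) := [set z | exists p, z = Dual (ev v p) (ev v p^`M(a))].
have GG0 : log_der setT G0.
  split.
  - exists 1; apply: dual_eq; rewrite ?reE ?epsE ?ev1 //.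
    by rewrite -mpolyC1 mderivC ev0.
  - move=> _ _ [p ->] [q ->]; exists (p - q); apply: dual_eq.
      by rewrite rmorphB /= !reE evB.
    by rewrite raddfB /= !epsE mderivB evB.
  - move=> _ _ [p ->] [q ->]; exists (p * q); apply: dual_eq.
      by rewrite rmorphM /= !reE evM.
    by rewrite epsM !epsE !reE mderivM evD !evM.
  - move=> _ [p ->]; rewrite /log_bounded reE epsE.
    have [p0|p0] := eqVneq (ev v p) 0; last exact: vdvd_trivial.
    rewrite (iv _ p0) mderiv0 ev0.
    exact: (vdvd0 (val_ring_trivial charE)).
have [D [DD HD]] := derivation_extends cE charE GG0.
have DE p : D (ev v p) = ev v p^`M(a).
  by rewrite -[LHS](HD (Dual (ev v p) (ev v p^`M(a)))) //; exists p.
exists D; split.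
  by split=> // c; rewrite -(evC v) DE mderivC ev0.
move=> b; rewrite -(evX v b) DE mderivX mnm1E eq_sym.
have [<-|ab] := eqVneq a b; last by rewrite scale0r ev0.
by rewrite scale1r submm mpolyX0 ev1.
Qed.

Lemma msize_deriv_lt n (p : {mpoly K[n]}) k : p != 0 -> (msize p^`M(k) < msize p)%N.
Proof.
move=> p0; have sp : (0 < msize p)%N by rewrite lt0n msize_poly_eq0.
rewrite msizeE; rewrite -[X in (_ < X)%N](prednK sp) ltnS.
apply/bigmax_leqP_seq => m mp _.
have : (m + U_(k))%MM \in msupp p.
  rewrite mcoeff_msupp; move: mp; rewrite mcoeff_msupp mcoeff_deriv.
  by apply: contraNneq => ->; rewrite mul0rn.
move/msize_mdeg_lt; rewrite mdegD mdeg1 addn1 => H.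
by rewrite -ltnS prednK.
Qed.

Lemma mderiv_eq0_const n (p : {mpoly K[n]}) :
  (forall k, p^`M(k) = 0) -> p = (p@_0%MM)%:MP.
Proof.
move=> dp; apply/mpolyP => m; rewrite mcoeffC.
have [->|m0] := eqVneq m 0%MM; first by rewrite mulr1.
rewrite mulr0; have [k mk] : exists k, m k != 0%N.
  apply: contrapT => N; case/eqP: m0; apply/mnmP => k; rewrite mnm0E.
  by apply: contrapT => mk; apply: N; exists k; apply/eqP.
have := congr1 (mcoeff (m - U_(k))%MM) (dp k).
rewrite mcoeff_deriv mcoeff0 submK ?lep1mP // => /eqP.
rewrite -mulr_natr mulf_eq0 => /orP[/eqP//|].
by rewrite -(fmorph_eq0 f) rmorph_nat (negPf (charE _)).
Qed.

(** Applying the derivations to a relation [p(v) = 0] shows that the partial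
    derivatives of [p] give relations too; by induction on the degree they vanish, so
    in characteristic zero [p] is constant. *)
Lemma jacobian_criterion n t (v : 'I_n -> E) (D : 'I_t -> E -> E) :
  (forall a, const_der (D a)) ->
  (forall x : 'I_n -> E, (forall a, \sum_b x b * D a (v b) = 0) -> forall b, x b = 0) ->
  alg_indep v.
Proof.
move=> cD nonsing p; have [k] := ubnP (msize p); elim: k p => // k IH p sp p0.
have [->//|pn0] := eqVneq p 0.
have dp b : p^`M(b) = 0.
  apply: IH; first exact: leq_trans (msize_deriv_lt b pn0) sp.
  apply: (nonsing (fun b => ev v p^`M(b))) => a.
  by rewrite -(ev_der v p (cD a)) p0 (der0 (proj1 (cD a))).
have Ep := mderiv_eq0_const dp.
move: p0; rewrite Ep evC => /eqP; rewrite fmorph_eq0 => /eqP ->.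
by rewrite mpolyC0.
Qed.

End Transcendence.

(** * Generic points *)

Definition rename_vars (K : fieldType) (t n : nat) (j : 'I_t -> 'I_n)
    (p : {mpoly K[t]}) : {mpoly K[n]} := p \mPo [tuple 'X_(j i) | i < t].

Lemma ev_rename (K E : fieldType) (f : {rmorphism K -> E}) t n (j : 'I_t -> 'I_n)
    (p : {mpoly K[t]}) (v : 'I_n -> E) :
  ev f v (rename_vars j p) = ev f (v \o j) p.
Proof.
rewrite /rename_vars; elim/mpoly_ring_ind: p => [c|i|p q Hp Hq|p q Hp Hq].
- by rewrite comp_mpolyC !evC.
- by rewrite comp_mpolyXU -tnth_nth tnth_mktuple !evX.
- by rewrite comp_mpolyD !evD; congr (_ + _).
- by rewrite [_ \mPo _]rmorphM !evM; congr (_ * _).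
Qed.

Lemma ev_idfun (K : fieldType) n (v : 'I_n -> K) (p : {mpoly K[n]}) :
  ev idfun v p = p.@[v].
Proof. by rewrite evE -[RHS](meval_map idfun). Qed.

Lemma meval_rename (K : fieldType) t n (j : 'I_t -> 'I_n) (p : {mpoly K[t]})
    (v : 'I_n -> K) : (rename_vars j p).@[v] = p.@[v \o j].
Proof. by rewrite -!ev_idfun ev_rename. Qed.

Definition vanishes_on (K : fieldType) n (C : set ('I_n -> K)) (p : {mpoly K[n]}) :=
  forall u, C u -> p.@[u] = 0.

Definition prime_on (K : fieldType) n (C : set ('I_n -> K)) : Prop :=
  ~ vanishes_on C 1 /\
  forall p q, vanishes_on C (p * q) -> vanishes_on C p \/ vanishes_on C q.

Definition indep_on (K : fieldType) n (C : set ('I_n -> K)) t (j : 'I_t -> 'I_n) :=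
  forall p : {mpoly K[t]}, (forall u, C u -> p.@[u \o j] = 0) -> p = 0.

Definition generic_point (K : fieldType) n (U : ultra ('I_n -> K)) (k : 'I_n) :
  upow U K := cl U (fun u => u k).

Lemma ev_generic (K : fieldType) n (U : ultra ('I_n -> K)) (p : {mpoly K[n]}) :
  ev (diag U) (generic_point U) p = cl U (fun u => p.@[u]).
Proof. by rewrite evE; exact: (diag_meval U p (fun k u => u k)). Qed.

(** For a prime [C] the nonvanishing loci of the polynomials that are nonzero on [C]
    generate a filter. *)
Lemma generic_exists (K : fieldType) n (C : set ('I_n -> K)) : prime_on C ->
  exists U : ultra ('I_n -> K), ae U C /\
    forall p, ev (diag U) (generic_point U) p = 0 <-> vanishes_on C p.
Proof.
move=> [n1 pC]; pose J := {p : {mpoly K[n]} | ~ vanishes_on C p}.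
have [p|p q|U HU] := @ultra_exists ('I_n -> K) J (exist _ 1 n1)
    (fun p => [set u | C u /\ (sval p).@[u] != 0]).
- apply: contrapT => N; apply: (svalP p) => u Cu.
  by apply: contrapT => /eqP pu; apply: N; exists u.
- case: p q => p np [q nq].
  have npq : ~ vanishes_on C (p * q) by case/pC.
  exists (exist _ (p * q) npq) => u /= [Cu].
  by rewrite mevalM mulf_eq0 negb_or => /andP[].
exists U; split; first by apply: ae_mono (HU (exist _ 1 n1)) _ => u [].
move=> p; rewrite ev_generic; split=> [/cl0P H|vp].
  apply: contrapT => np; apply: (@ae_false _ U).
  by apply: ae_mono (ae_and H (HU (exist _ p np))) _ => u [pu [_ /eqP]]; apply.
apply/cl0P; apply: ae_mono (HU (exist _ 1 n1)) _ => u [Cu _]; exact: vp.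
Qed.

Section Growth.
Variables (K E : fieldType) (f : {rmorphism K -> E}) (n : nat).
Variables (C C' : set ('I_n -> K)) (q : {mpoly K[n]}) (al : 'I_n -> E).
Hypotheses (cE : alg_closed E) (charE : forall k, k.+1%:R != 0 :> E).
Hypothesis al_generic : forall p, ev f al p = 0 <-> vanishes_on C' p.
Hypotheses (CC' : C `<=` C') (qC : vanishes_on C q) (qC' : ~ vanishes_on C' q).

(** If [q(al)] were algebraic over the coordinates [j] of the generic point of [C'],
    then the constant term of a relation would vanish on [C], where [q] does, against
    independence.  So some derivation kills these coordinates but not [q(al)], hence
    does not kill some further coordinate of [al].  The Jacobian criterion allows to
    add the latter. *)
Lemma indep_on_extend t (j : 'I_t -> 'I_n) : indep_on C j ->
  exists j' : 'I_t.+1 -> 'I_n, indep_on C' j'.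
Proof.
move=> ij.
have iE : alg_indep f (al \o j).
  move=> p p0; apply: ij => u Cu; rewrite -meval_rename.
  by move: p0; rewrite -ev_rename => /al_generic; apply; exact: CC'.
pose y := ev f al q.
have y0 : y != 0 by apply/eqP => /al_generic.
pose G0 : set (dual E) := [set z | exists p, z = Dual (ev f (al \o j) p) 0].
have GG0 : log_der setT G0.
  split.
  - by exists 1; apply: dual_eq; rewrite ?reE ?epsE ?ev1.
  - move=> _ _ [p ->] [r ->]; exists (p - r); apply: dual_eq.
      by rewrite rmorphB /= !reE evB.
    by rewrite raddfB /= !epsE subrr.
  - move=> _ _ [p ->] [r ->]; exists (p * r); apply: dual_eq.
      by rewrite rmorphM /= !reE evM.
    by rewrite epsM !epsE mul0r mulr0 addr0.
  - by move=> _ [p ->]; rewrite /log_bounded epsE; exact: (vdvd0 (val_ring_trivial charE)).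
(* The value y of q is transcendental over the coordinates in j. *)
have trans (h : {poly dual E}) : pover G0 h ->
    (exists P, (map_poly re h).[y] = ev f al P) /\ ((map_poly re h).[y] = 0 -> h = 0).
  move: h; apply: pover_ind.
    by rewrite rmorph0; split=> //; exists 0; rewrite horner0 ev0.
  move=> h _ _ [c ->] [[P HP] h0].
  have Eh : (map_poly re (h * 'X + (Dual (ev f (al \o j) c) 0)%:P)).[y]
      = ev f al (P * q + rename_vars j c).
    rewrite rmorphD rmorphM /= map_polyX map_polyC /= hornerMXaddC HP.
    by rewrite evD evM ev_rename reE.
  split; first by exists (P * q + rename_vars j c).
  rewrite Eh => E0; have c0 : c = 0.
    apply: ij => u Cu; have := (proj1 (al_generic _) E0) u (CC' Cu).
    by rewrite mevalD mevalM (qC Cu) mulr0 add0r meval_rename.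
  move: E0; rewrite c0 evD evM ev_rename [ev _ _ 0]ev0 addr0 -HP => /eqP.
  rewrite mulf_eq0 (negPf y0) orbF => /eqP/h0 ->.
  rewrite mul0r add0r.
  by have -> : Dual 0 0 = 0 :> dual E by []; rewrite polyC0.
have [|G1 [GG1 s1 G1y]] := log_der_adjoin GG0 (z := Dual y 1).
  move=> h Hh; rewrite /log_bounded -horner_map /= reE.
  have [/(proj2 (trans h Hh)) ->|hy] := eqVneq (map_poly re h).[y] 0.
    by rewrite horner0 raddf0; exact: (vdvd0 (val_ring_trivial charE)).
  exact: vdvd_trivial.
have [D [DD HD]] := derivation_extends cE charE GG1.
have Dj p : D (ev f (al \o j) p) = 0.
  by rewrite -(HD (Dual (ev f (al \o j) p) 0)) //; apply: s1; exists p.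
have cD : const_der f D.
  by split=> // c; rewrite -(evC _ (al \o j)) Dj.
have [k Dk] : exists k, D (al k) != 0.
  apply: contrapT => N; have := HD _ G1y; rewrite epsE reE (ev_der _ _ cD) big1.
    by move/eqP; rewrite oner_eq0.
  move=> k _; apply/eqP; rewrite mulf_eq0; apply/orP; right.
  by apply: contrapT => /negP Dk; apply: N; exists k.
have [Da HDa] := alg_indep_dual_ders cE charE iE.
pose j' (b : 'I_t.+1) : 'I_n := if unlift ord_max b is Some b' then j b' else k.
pose D' (a : 'I_t.+1) : E -> E := if unlift ord_max a is Some a' then Da a' else D.
exists j' => p Hp.
suff iE' : alg_indep f (al \o j').
  apply: iE'; rewrite -ev_rename; apply/al_generic => u C'u.
  by rewrite meval_rename; exact: Hp.
have j'm : j' ord_max = k by rewrite /j' unlift_none.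
have j'l b : j' (lift ord_max b) = j b by rewrite /j' liftK.
apply: (jacobian_criterion charE (D := D')) => [a|x Hx].
  by rewrite /D'; case: unliftP => [a' _|_]; [case: (HDa a')|].
have sum_split (F : 'I_t.+1 -> E) :
    \sum_b F b = \sum_b F (lift ord_max b) + F ord_max.
  rewrite big_ord_recr /=; congr (_ + _); apply: eq_bigr => b _; congr F.
  by apply: val_inj; rewrite /= /bump leqNgt ltn_ord.
have xm : x ord_max = 0.
  have := Hx ord_max; rewrite sum_split /D' unlift_none /= j'm big1 ?add0r.
    by move/eqP; rewrite mulf_eq0 (negPf Dk) orbF => /eqP.
  move=> b _; rewrite j'l; have := Dj 'X_b; rewrite evX /= => ->.
  by rewrite mulr0.
move=> b; case: (unliftP ord_max b) => [b' ->|-> //].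
have := Hx (lift ord_max b'); rewrite sum_split /D' liftK xm mul0r addr0.
rewrite (bigD1 b') //= big1 ?addr0.
  by rewrite j'l; have [_ ->] := HDa b'; rewrite eqxx mulr1.
move=> c cb; rewrite j'l; have [_ ->] := HDa b'.
by rewrite eq_sym (negPf cb) mulr0.
Qed.

End Growth.

Lemma indep_on_grows (K : fieldType) n (C C' : set ('I_n -> K)) (q : {mpoly K[n]})
    t (j : 'I_t -> 'I_n) :
  alg_closed K -> (forall k, k.+1%:R != 0 :> K) -> prime_on C' ->
  C `<=` C' -> vanishes_on C q -> ~ vanishes_on C' q -> indep_on C j ->
  exists j' : 'I_t.+1 -> 'I_n, indep_on C' j'.
Proof.
move=> cK charK pC' CC' qC qC'; have [U [_ Up]] := generic_exists pC'.
apply: (indep_on_extend (upow_alg_closed cK) _ Up CC' qC qC') => k.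
by rewrite -(rmorph_nat (diag U)) fmorph_eq0.
Qed.

(** * Hilbert's basis theorem *)

Lemma nat_monotone_subsequence (x : nat -> nat) :
  exists phi : nat -> nat, (forall i, (phi i < phi i.+1)%N) /\
    (forall i, (x (phi i) <= x (phi i.+1))%N).
Proof.
have /choice[m Hm] : forall b, exists i, (b <= i)%N /\ forall j, (b <= j)%N -> (x i <= x j)%N.
  move=> b; have H : exists v, `[< exists2 i, (b <= i)%N & x i = v >].
    by exists (x b); apply/asboolP; exists b.
  case: (ex_minnP H) => v /asboolP[i bi xi] min; exists i; split=> // j bj.
  by rewrite xi; apply: min; apply/asboolP; exists j.
pose phi := fix phi k := if k is k'.+1 then m (phi k').+1 else m 0%N.
have phiS i : (phi i < phi i.+1)%N by have [] := Hm (phi i).+1.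
exists phi; split=> // i; case: i => [|i].
  by have [_ ->] := Hm 0%N.
have [_ ->] // := Hm (phi i).+1.
exact: leq_trans (phiS i) (ltnW (phiS i.+1)).
Qed.

Lemma dickson n (a : nat -> 'X_{1..n}) : exists i j, (i < j)%N /\ (a i <= a j)%MM.
Proof.
suff H (s : seq 'I_n) : exists phi : nat -> nat, (forall i, (phi i < phi i.+1)%N) /\
    forall k, k \in s -> forall i, (a (phi i) k <= a (phi i.+1) k)%N.
  have [phi [phiS mono]] := H (enum 'I_n); exists (phi 0%N), (phi 1%N).
  by split=> //; apply/mnm_lepP => k; apply: mono; rewrite mem_enum.
elim: s => [|k s [phi [phiS mono]]]; first by exists id; split.
have [psi [psiS mono']] := nat_monotone_subsequence (fun i => a (phi i) k).
have phi_homo := homo_ltn ltn_trans phiS.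
exists (phi \o psi); split=> [i|l]; first exact: phi_homo.
rewrite inE => /orP[/eqP-> i|ls i]; first exact: mono'.
have mono_l := homo_leq (f := fun i => a (phi i) l) (r := fun x y => (x <= y)%N)
  leqnn leq_trans (mono l ls).
exact: (mono_l _ _ (ltnW (psiS i))).
Qed.

Section Hilbert.
Variables (n : nat) (K : fieldType).
Implicit Types (p q : {mpoly K[n]}) (f : nat -> {mpoly K[n]}).

Definition partial_ideal f k p : Prop :=
  exists c : nat -> {mpoly K[n]}, p = \sum_(i < k) c i * f i.

Lemma partial_ideal_widen f k l p : (k <= l)%N ->
  partial_ideal f k p -> partial_ideal f l p.
Proof.
move=> kl [c ->]; exists (fun i => if (i < k)%N then c i else 0).
rewrite (big_ord_widen l (fun i => c i * f i) kl) big_mkcond.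
by apply: eq_bigr => i _; case: ifP => // _; rewrite mul0r.
Qed.

Lemma partial_idealB f k p q :
  partial_ideal f k p -> partial_ideal f k q -> partial_ideal f k (p - q).
Proof.
move=> [c ->] [d ->]; exists (fun i => c i - d i).
by rewrite -sumrB; apply: eq_bigr => i _; rewrite mulrBl.
Qed.

Lemma partial_idealD f k p q :
  partial_ideal f k p -> partial_ideal f k q -> partial_ideal f k (p + q).
Proof.
move=> [c ->] [d ->]; exists (fun i => c i + d i).
by rewrite -big_split; apply: eq_bigr => i _; rewrite mulrDl.
Qed.

Lemma partial_idealM f k p q : partial_ideal f k q -> partial_ideal f k (p * q).
Proof.
move=> [c ->]; exists (fun i => p * c i).
by rewrite mulr_sumr; apply: eq_bigr => i _; rewrite mulrA.
Qed.

Lemma mlead_cancel p q : p != 0 -> q != 0 -> (mlead q <= mlead p)%MM ->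
  exists r, p - r * q != 0 -> (mlead (p - r * q)%R < mlead p)%O.
Proof.
move=> p0 q0 le; have lp : mleadc p != 0 by rewrite mleadc_eq0.
have lq : mleadc q != 0 by rewrite mleadc_eq0.
pose m := (mlead p - mlead q)%MM; pose c := mleadc p / mleadc q.
have c0 : c != 0 by rewrite mulf_neq0 ?invr_eq0.
have mm : (m + mlead q)%MM = mlead p by rewrite submK.
exists (c *: 'X_[m]) => d0; set d := p - _.
have qE : c *: 'X_[m] * q = c *: (q * 'X_[m]) by rewrite -scalerAl mulrC.
have qs k : k \in msupp (c *: 'X_[m] * q) -> (k <= mlead p)%O.
  rewrite qE => /msuppZ_le; rewrite (perm_mem (msuppMX _ _)) => /mapP[l lq' ->].
  by rewrite -mm lemc_add2r msupp_le_mlead.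
have dlead : d@_(mlead p) = 0.
  by rewrite /d qE mcoeffB mcoeffZ -mm mcoeffMX mm /c divfK // subrr.
have dsupp := mlead_supp d0.
rewrite Order.POrderTheory.lt_neqAle; apply/andP; split.
  by apply: contraTneq dsupp => ->; rewrite mcoeff_msupp dlead eqxx.
have := msuppB_le dsupp; rewrite mem_cat => /orP[/msupp_le_mlead//|]; exact: qs.
Qed.

Lemma mnm_minimal (P : 'X_{1..n} -> Prop) : (exists m, P m) ->
  exists2 m, P m & forall m', P m' -> ~~ (m' < m)%O.
Proof.
move=> [m Pm]; elim/(well_founded_ind (@ltom_wf n)): m Pm => m IH Pm.
have [[m' [Pm' lt]]|N] := pselect (exists m', P m' /\ (m' < m)%O).
  exact: IH lt Pm'.
by exists m => // m' Pm'; apply/negP => lt; apply: N; exists m'.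
Qed.

(** Otherwise choose [g k] in the ideal of index [k.+1] but not in that of index [k],
    with the smallest possible leading monomial.  By Dickson's lemma some leading
    monomial divides a later one, and the corresponding later [g j] can be reduced to
    an element of the same kind with a smaller leading monomial. *)
Lemma partial_ideal_stationary f : exists k, partial_ideal f k (f k).
Proof.
apply: contrapT => N0; have N k : ~ partial_ideal f k (f k) by move=> ?; apply: N0; exists k.
have /choice[g Hg] : forall k, exists g, [/\ partial_ideal f k.+1 g, ~ partial_ideal f k g &
    forall h, partial_ideal f k.+1 h -> ~ partial_ideal f k h -> ~~ (mlead h < mlead g)%O].
  move=> k.
  have [|m [g [g1 g2 <-]] min] := @mnm_minimal (fun m => exists g,
      [/\ partial_ideal f k.+1 g, ~ partial_ideal f k g & mlead g = m]).
    exists (mlead (f k)), (f k); split=> //.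
    exists (fun i => (i == k)%:R); rewrite big_ord_recr /= eqxx mul1r big1 ?add0r //.
    by move=> i _; rewrite (ltn_eqF (ltn_ord i)) mul0r.
  by exists g; split=> // h h1 h2; apply: min; exists h.
have [i [j [ij le]]] := dickson (fun k => mlead (g k)).
have I0 k : partial_ideal f k 0.
  by exists (fun _ => 0); rewrite big1 // => l _; rewrite mul0r.
have g0 k : g k != 0 by apply/eqP => gk; have [_ + _] := Hg k; rewrite gk; apply.
have [r Hr] := mlead_cancel (g0 j) (g0 i) le.
have [gi _ _] := Hg i; have [gj ngj min] := Hg j.
have rgi : partial_ideal f j (r * g i).
  by apply: partial_idealM; exact: partial_ideal_widen gi.
have nd : ~ partial_ideal f j (g j - r * g i).
  move=> d; apply: ngj; rewrite -(subrK (r * g i) (g j)).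
  exact: partial_idealD.
have d0 : g j - r * g i != 0 by apply/eqP => d0; apply: nd; rewrite d0.
have := min (g j - r * g i) _ nd; rewrite Hr // => /(_ _)/negP[] //.
by apply: partial_idealB => //; exact: partial_ideal_widen rgi.
Qed.

(** The generators are members of [F] itself, so that they inherit properties such as
    homogeneity. *)
Theorem hilbert_basis (F : set {mpoly K[n]}) : exists s (g : 'I_s -> {mpoly K[n]}),
  (forall i, F (g i)) /\
  forall p, F p -> exists c : 'I_s -> {mpoly K[n]}, p = \sum_i c i * g i.
Proof.
apply: contrapT => N.
have /choice[next Hnext] : forall l : seq {mpoly K[n]}, exists p,
    (forall i, (i < size l)%N -> F l`_i) -> F p /\
    forall c : nat -> {mpoly K[n]}, p <> \sum_(i < size l) c i * l`_i.
  move=> l; have [lF|nF] := pselect (forall i, (i < size l)%N -> F l`_i); last by exists 0.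
  apply: contrapT => N1; apply: N; exists (size l), (fun i => l`_i).
  split=> [i|p Fp]; first exact: lF.
  apply: contrapT => N2; apply: N1; exists p => _; split=> // c pc.
  by apply: N2; exists c.
pose ls := fix ls k := if k is k'.+1 then rcons (ls k') (next (ls k')) else [::].
pose f k := next (ls k).
have size_ls k : size (ls k) = k by elim: k => //= k IH; rewrite size_rcons IH.
have nth_ls k i : (i < k)%N -> (ls k)`_i = f i.
  elim: k => // k IH; rewrite ltnS leq_eqVlt /= nth_rcons size_ls => /orP[/eqP->|ik].
    by rewrite ltnn eqxx.
  by rewrite ik IH.
have lsF k : forall i, (i < size (ls k))%N -> F (ls k)`_i.
  elim: k => // k IH i; rewrite size_ls ltnS leq_eqVlt /= nth_rcons size_ls => /orP[/eqP->|ik].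
    by rewrite ltnn eqxx; have [] := Hnext _ IH.
  by rewrite ik; apply: IH; rewrite size_ls.
have [k [c Ek]] := partial_ideal_stationary f.
have [_ /(_ c)] := Hnext _ (lsF k); apply; rewrite -/(f k) Ek size_ls.
by apply: eq_bigr => i _; rewrite nth_ls.
Qed.

End Hilbert.

(** * Weighted homogeneous parts *)

Definition weighted_deg n (w : 'I_n -> nat) (m : 'X_{1..n}) : nat :=
  (\sum_i m i * w i)%N.

Section WeightedDegree.
Variables (n : nat) (w : 'I_n -> nat).

Lemma weighted_deg0 : weighted_deg w 0%MM = 0%N.
Proof. by rewrite /weighted_deg big1 // => i _; rewrite mnm0E mul0n. Qed.

Lemma weighted_degD :
  {morph weighted_deg w : m1 m2 / (m1 + m2)%MM >-> (m1 + m2)%N}.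
Proof.
move=> m1 m2; rewrite /weighted_deg -big_split /=.
by apply: eq_bigr => i _; rewrite mnmDE mulnDl.
Qed.

HB.instance Definition _ :=
  isMeasure.Build n (weighted_deg w) weighted_deg0 weighted_degD.

End WeightedDegree.

Section WeightedParts.
Variables (K : fieldType) (n : nat) (w : 'I_n -> nat).
Hypothesis charK : forall k, k.+1%:R != 0 :> K.
Implicit Types (p : {mpoly K[n]}) (v : 'I_n -> K).

(** Constant weights give the homogeneous parts; weights zero and one give the parts
    that are homogeneous in some of the variables. *)
Definition wpart (d : nat) p : {mpoly K[n]} :=
  pihomog (Measure.clone n (weighted_deg w) _) d p.

Lemma mcoeff_wpart d p m :
  (wpart d p)@_m = if weighted_deg w m == d then p@_m else 0.
Proof.
rewrite /wpart pihomogE raddf_sum /=.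
under eq_bigr => k _ do rewrite mcoeffZ mcoeffX.
have [mp|mp] := boolP (m \in msupp p); last first.
  rewrite (memN_msupp_eq0 mp) if_same big1_seq // => k /andP[_ kp].
  by case: eqP kp mp => [->->//|_ _ _]; rewrite mulr0.
case: ifP => md.
  rewrite big_mkcond (bigD1_seq m) ?msupp_uniq //= md eqxx mulr1 big1 ?addr0 //.
  by move=> k /negPf km; rewrite km mulr0 if_same.
rewrite big1 // => k kd; case: eqP => [km|_]; last by rewrite mulr0.
by move: md; rewrite -km kd.
Qed.

Lemma meval_weighted d p v (s : K) :
  (forall m, m \in msupp p -> weighted_deg w m = d) ->
  p.@[fun i => s ^+ w i * v i] = s ^+ d * p.@[v].
Proof.
move=> hp; rewrite !mevalE mulr_sumr big_seq [RHS]big_seq.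
apply: eq_bigr => m mp; rewrite -(hp m mp) mulrCA; congr (_ * _).
under eq_bigr => i _ do rewrite exprMn -exprM mulnC.
by rewrite big_split /= prodrXr.
Qed.

Lemma wpart_homog d p m : m \in msupp (wpart d p) -> weighted_deg w m = d.
Proof.
rewrite mcoeff_msupp mcoeff_wpart; case: ifP => [/eqP//|_]; by rewrite eqxx.
Qed.

Lemma wpart_sum p : exists k, p = \sum_(d < k) wpart d p.
Proof. by eexists; apply: pihomog_partitionE. Qed.

Lemma poly_eq0_nonzero (q : {poly K}) : (forall s, s != 0 -> q.[s] = 0) -> q = 0.
Proof.
move=> H; apply/eqP/negPn/negP => q0.
have := @max_poly_roots _ q [seq i.+1%:R | i <- iota 0 (size q)] q0.
rewrite size_map size_iota ltnn => maxr; suff: false by []; apply: maxr.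
  by apply/allP => _ /mapP[i _ ->]; apply/rootP/H.
rewrite map_inj_uniq ?iota_uniq // => i j /eqP.
wlog ij : i j / (i <= j)%N.
  move=> W; case: (leqP i j) => [H1 H2|/ltnW H1 H2]; first exact: (W i j).
  by symmetry; apply: (W j i) => //; rewrite eq_sym.
rewrite -subr_eq0 -opprB oppr_eq0 -natrB // subSS.
by case E : (j - i)%N => [|e]; rewrite ?(negPf (charK _)) // => _; lia.
Qed.

(** The values are the coefficients of a polynomial in [s] with infinitely many
    zeros. *)
Lemma wparts_vanish p v :
  (forall s, s != 0 -> p.@[fun i => s ^+ w i * v i] = 0) ->
  forall d, (wpart d p).@[v] = 0.
Proof.
move=> H; have [k Ep] := wpart_sum p.
pose q := \poly_(d < k) (wpart d p).@[v].
have q0 : q = 0.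
  apply: poly_eq0_nonzero => s s0; apply: (etrans _ (H s s0)).
  rewrite horner_poly [in RHS]Ep meval_sum.
  by apply: eq_bigr => d _; rewrite (meval_weighted _ _ (@wpart_homog d p)) mulrC.
move=> d; have := congr1 (fun q : {poly K} => q`_d) q0; rewrite coef0 coef_poly.
case: ltnP => // kd _.
suff -> : wpart d p = 0 by rewrite meval0.
apply/mpolyP => m; rewrite mcoeff0 mcoeff_wpart; case: eqP => // md.
rewrite Ep raddf_sum /= big1 // => e _; rewrite mcoeff_wpart md.
by rewrite gtn_eqF //; exact: leq_trans (ltn_ord e) kd.
Qed.

Lemma wparts_vanish_scale p v : (forall d, (wpart d p).@[v] = 0) ->
  forall s, p.@[fun i => s ^+ w i * v i] = 0.
Proof.
move=> H s; have [k ->] := wpart_sum p; rewrite meval_sum big1 // => d _.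
by rewrite (meval_weighted _ _ (@wpart_homog d p)) H mulr0.
Qed.

End WeightedParts.

(** * Cones over projective sets *)

Lemma proj_generator (K : fieldType) N (x : proj K N) :
  exists2 u, u != 0 & line_of x = <[u]>%VS.
Proof.
case: x => L HL; rewrite /line_of /=; have /eqP dL := HL.
have L0 : L != 0%VS by rewrite -dimv_eq0 dL.
exists (vpick L); first by rewrite vpick0.
apply/eqP; rewrite eq_sym eqEdim dL dim_vline vpick0 L0 andbT.
by rewrite -memvE memv_pick.
Qed.

Definition cone (K : fieldType) N (Z : set (proj K N)) : set ('I_N.+1 -> K) :=
  [set v | exists2 x, Z x & exists2 u, u \in line_of x & v = u 0].

Lemma weighted_deg1 n (m : 'X_{1..n}) : weighted_deg (fun _ => 1%N) m = mdeg m.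
Proof. by rewrite mdegE; apply: eq_bigr => i _; rewrite muln1. Qed.

Section Projective.
Variables (K : fieldType) (N : nat).
Hypothesis charK : forall k, k.+1%:R != 0 :> K.
Local Notation part d p := (wpart (fun _ : 'I_N.+1 => 1%N) d p).

Lemma part_homogeneous d (p : {mpoly K[N.+1]}) : homogeneous (part d p).
Proof.
by exists d; apply/dhomogP => m /wpart_homog; rewrite weighted_deg1.
Qed.

Lemma vanishes_at_parts (p : {mpoly K[N.+1]}) (x : proj K N) u :
  line_of x = <[u]>%VS -> vanishes_at p x <-> forall d, (part d p).@[u 0] = 0.
Proof.
move=> xu; split=> [px|H].
  apply: (wparts_vanish charK) => s _.
  rewrite -(px (s *: u)); last by rewrite xu memvZ ?memv_line.
  by apply: meval_eq => i; rewrite mxE expr1.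
move=> v; rewrite xu => /vlineP[s ->].
rewrite -[RHS](wparts_vanish_scale H s).
by apply: meval_eq => i; rewrite mxE expr1.
Qed.

(** The closed set is cut out by the homogeneous parts of [p]. *)
Lemma proj_closed_vanishing (p : {mpoly K[N.+1]}) :
  proj_closed [set x : proj K N | vanishes_at p x].
Proof.
exists [set q | exists d, q = part d p].
  by move=> _ [d ->]; exact: part_homogeneous.
apply/seteqP; split=> x /=; have [u _ xu] := proj_generator x.
  move=> /(vanishes_at_parts _ xu) H _ [d ->] v; rewrite xu => /vlineP[s ->].
  have [e /dhomogP he] := part_homogeneous d p.
  rewrite (meval_eq (v2 := fun i => s ^+ 1 * u 0 i)); last by move=> i; rewrite mxE expr1.
  rewrite (meval_weighted (w := fun _ => 1%N) (d := e)) ?H ?mulr0 // => m /he.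
  by rewrite weighted_deg1.
move=> H; apply/(vanishes_at_parts _ xu) => d; apply: H; first by exists d.
by rewrite xu memv_line.
Qed.

Lemma vanishes_on_cone (Z : set (proj K N)) p :
  vanishes_on (cone Z) p <-> forall x, Z x -> vanishes_at p x.
Proof.
split=> [H x Zx u ux|H _ [x Zx [u ux ->]]]; last exact: H ux.
by apply: H; exists x => //; exists u.
Qed.

(** Along a line through the origin, polynomials become polynomials in one variable,
    which form a domain. *)
Lemma vanishes_at_mul (p q : {mpoly K[N.+1]}) (x : proj K N) :
  vanishes_at (p * q) x -> vanishes_at p x \/ vanishes_at q x.
Proof.
have [u _ xu] := proj_generator x => H.
pose w := fun _ : 'I_N.+1 => 1%N.
have [k Ek] := wpart_sum w p; have [l El] := wpart_sum w q.
pose P := \poly_(d < k) (part d p).@[u 0]; pose Q := \poly_(d < l) (part d q).@[u 0].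
have scal (r : {mpoly K[N.+1]}) b (Er : r = \sum_(d < b) part d r) s :
    (\poly_(d < b) (part d r).@[u 0]).[s] = r.@[(s *: u) 0].
  rewrite horner_poly [in RHS]Er meval_sum; apply: eq_bigr => d _.
  rewrite mulrC -(meval_weighted (w := w) _ _ (@wpart_homog K _ w d r)).
  by apply: meval_eq => i; rewrite mxE expr1.
have PQ : P * Q = 0.
  apply: (poly_eq0_nonzero charK) => s _; rewrite hornerM !scal // -mevalM.
  by apply: H; rewrite xu memvZ ?memv_line.
have van r b (Er : r = \sum_(d < b) part d r) :
    \poly_(d < b) (part d r).@[u 0] = 0 -> vanishes_at r x.
  move=> P0 v; rewrite xu => /vlineP[s ->].
  by rewrite -(scal r b Er) P0 horner0.
move/eqP: PQ; rewrite mulf_eq0 => /orP[]/eqP.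
  by left; exact: (van _ _ Ek).
by right; exact: (van _ _ El).
Qed.

Lemma irreducible_prime_on (Z : set (proj K N)) :
  irreducible (@proj_closed K N) Z -> prime_on (cone Z).
Proof.
move=> [[x Zx] irr]; split=> [/vanishes_on_cone/(_ x Zx 0)|p q /vanishes_on_cone pq].
  by rewrite mem0v meval1 => /(_ isT)/eqP; rewrite oner_eq0.
have [|ZA|ZA] := irr _ _ (proj_closed_vanishing p) (proj_closed_vanishing q).
- by move=> y Zy; exact: vanishes_at_mul (pq y Zy).
- by left; apply/vanishes_on_cone => y /ZA.
- by right; apply/vanishes_on_cone => y /ZA.
Qed.

Lemma chain_separated (S : set (proj K N)) n Z : irred_chain (@proj_closed K N) S n Z ->
  forall i, (i < n)%N -> exists q, vanishes_on (cone (Z i)) q /\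
                                ~ vanishes_on (cone (Z i.+1)) q.
Proof.
move=> [HZ ltZ] i ni; have [sZ nZ] := ltZ i ni.
have [[C [I Ihom EC] EZ] _] := HZ i (ltnW ni).
have [[C' _ EZ'] _] := HZ i.+1 ni.
apply: contrapT => Nq; apply: nZ => x Zx.
rewrite EZ; split; first by move: Zx; rewrite EZ' => -[].
rewrite EC => p Ip; apply: contrapT => px; apply: Nq; exists p; split.
  by apply/vanishes_on_cone => y; rewrite EZ EC => -[_]; exact.
by move/vanishes_on_cone/(_ x Zx).
Qed.

(** The induction starts at the origin with the empty family.  The step from there to
    the cone over [Z 0] contributes one coordinate, and so does each step of the
    chain. *)
Lemma chain_indep (S : set (proj K N)) n Z : alg_closed K ->
  irred_chain (@proj_closed K N) S n Z ->
  exists j : 'I_n.+1 -> 'I_N.+1, indep_on (cone (Z n)) j.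
Proof.
move=> cK chain; have [HZ ltZ] := chain.
suff H i : (i <= n)%N -> exists j : 'I_i.+1 -> 'I_N.+1, indep_on (cone (Z i)) j by exact: H.
elim: i => [_|i IH ni].
  have [_ irr] := HZ 0%N (leq0n n); have [[x Zx] _] := irr.
  have [u u0 xu] := proj_generator x.
  have [k uk] : exists k, u 0 k != 0.
    apply: contrapT => Nk; case/eqP: u0; apply/rowP => k; rewrite mxE.
    by apply: contrapT => /eqP uk; apply: Nk; exists k.
  have cone0 : [set (fun _ => 0)] `<=` cone (Z 0%N).
    move=> _ ->; exists x => //; exists 0; first exact: mem0v.
    by apply/funext => l; rewrite mxE.
  have q0 : vanishes_on [set (fun _ => 0)] ('X_k : {mpoly K[N.+1]}).
    by move=> _ ->; rewrite mevalXU.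
  have j0 : 'I_0 -> 'I_N.+1 by case.
  apply: (indep_on_grows cK charK (irreducible_prime_on irr) cone0 q0 (j := j0)).
    move=> Hk; have := Hk (u 0); rewrite mevalXU => H.
    by case/eqP: uk; apply: H; exists x => //; exists u; rewrite ?xu ?memv_line.
  move=> p Hp; have := Hp _ erefl; rewrite [p]nvar0_mpolyC mevalC => ->.
  by rewrite mpolyC0.
have [j ij] := IH (ltnW ni); have [q [q1 q2]] := chain_separated chain ni.
have [_ irr] := HZ i.+1 ni; have [sZ _] := ltZ i ni.
apply: (indep_on_grows cK charK (irreducible_prime_on irr) _ q1 q2 ij).
by move=> _ [x Zx [u ux ->]]; exists x; [exact: sZ|exists u].
Qed.

End Projective.

(** * The conormal variety inside the closure of the conormal cone *)

Definition join (K : Type) n (u a : 'I_n -> K) (k : 'I_(n + n)) : K :=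
  match fintype.split k with inl i => u i | inr i => a i end.

Lemma join_l (K : Type) n (u a : 'I_n -> K) i : join u a (lshift n i) = u i.
Proof. by rewrite /join -[lshift n i]/(unsplit (inl i)) unsplitK. Qed.
Lemma join_r (K : Type) n (u a : 'I_n -> K) i : join u a (rshift n i) = a i.
Proof. by rewrite /join -[rshift n i]/(unsplit (inr i)) unsplitK. Qed.

Lemma row_mx_join (K : nzRingType) n (u a : 'rV[K]_n) :
  row_mx u a 0 =1 join (u 0) (a 0).
Proof. by move=> k; rewrite mxE /join; case: (fintype.split k). Qed.

Lemma map_mpoly_idfun (K : fieldType) n (p : {mpoly K[n]}) : map_mpoly idfun p = p.
Proof. by apply/mpolyP => m; rewrite mcoeff_map_mpoly. Qed.

Lemma deriv_homog_scale (K : fieldType) n d (g : {mpoly K[n]}) k (s : K) v :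
  g \is d.-homog ->
  g^`M(k).@[fun i => s * v i] = s ^+ d.-1 * g^`M(k).@[v].
Proof.
move=> hg.
rewrite -(meval_weighted (w := fun _ => 1%N)); first exact: meval_eq.
move=> m; rewrite weighted_deg1 mcoeff_msupp mcoeff_deriv => H.
have : (m + U_(k))%MM \in msupp g.
  by rewrite mcoeff_msupp; apply: contraNneq H => ->; rewrite mul0rn.
move=> mg; have <- : mdeg (m + U_(k)) = d by exact: (dhomog_mf hg mg).
by rewrite mdegD mdeg1 addn1.
Qed.

Section Conormal.
Variables (K : fieldType) (N : nat) (X : set (proj K N)).
Hypothesis charK : forall k, k.+1%:R != 0 :> K.
Variables (s : nat) (g : 'I_s -> {mpoly K[N.+1]}).
Hypothesis gX : forall i, in_ideal X (g i).
Hypothesis genX : forall p, in_ideal X p ->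
  exists c : 'I_s -> {mpoly K[N.+1]}, p = \sum_i c i * g i.

Local Notation CK := (conormal_cone (@idfun K) g).

(** A linear form that vanishes on the common kernel of the gradients of the [g i] is a
    combination of them; the gradients of the other equations of [X] are combinations
    of these as well. *)
Lemma tangent_hyperplane_in_cone (x h : proj K N) (U : {vspace 'rV[K]_N.+1}) u a :
  X x -> is_tangent_space X x U -> hyperplane_contains h U ->
  u != 0 -> u \in line_of x -> a \in line_of h -> CK (join (u 0) (a 0)).
Proof.
move=> Xx TU hU u0 ux ah.
have gu i w : w \in line_of x -> (g i).@[w 0] = 0.
  by move=> wx; have [_ H] := gX i; exact: H Xx _ wx.
have lineu w : w \in line_of x -> exists c, w = c *: u.
  have [v _ xv] := proj_generator x; move: ux; rewrite xv => /vlineP[b Eb] /vlineP[c ->].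
  have b0 : b != 0 by apply: contraNneq u0 => b0; rewrite Eb b0 scale0r.
  by exists (c / b); rewrite Eb scalerA divfK.
pose G : 'M[K]_(s, N.+1) := \matrix_(i, k) (g i)^`M(k).@[u 0].
have annih (v : 'rV[K]_N.+1) : G *m v^T = 0 -> v \in U.
  move=> Gv; apply/TU => p pX w wx; have [c Ew] := lineu w wx.
  have [d Ep] := genX pX.
  have Gi i : \sum_k (g i)^`M(k).@[w 0] * v 0 k = 0.
    have [[e he] _] := gX i.
    have Gv0 : \sum_k (g i)^`M(k).@[u 0] * v 0 k = 0.
      have := congr1 (fun M : 'cV[K]_s => M i 0) Gv; rewrite !mxE; apply: etrans.
      by apply: eq_bigr => k _; rewrite !mxE.
    apply: (etrans _ (etrans (congr1 ( *%R (c ^+ e.-1)) Gv0) (mulr0 _))).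
    rewrite mulr_sumr; apply: eq_bigr => k _; rewrite mulrA.
    rewrite -(deriv_homog_scale k c (u 0) he); congr (_ * _).
    by apply: meval_eq => i'; rewrite Ew mxE.
  rewrite Ep.
  have E k : (\sum_i d i * g i)^`M(k).@[w 0] = \sum_i (d i).@[w 0] * (g i)^`M(k).@[w 0].
    rewrite [(\sum_i _)^`M(k)]raddf_sum meval_sum; apply: eq_bigr => i _ /=.
    by rewrite mderivM mevalD !mevalM (gu i w wx) mulr0 add0r.
  under eq_bigr => k _ do rewrite E mulr_suml.
  rewrite exchange_big big1 // => i _.
  by under eq_bigr => k _ do rewrite -mulrA; rewrite -mulr_sumr Gi mulr0.
have /submxP[l Hl] : (a <= G)%MS.
  rewrite submxE; apply/eqP/rowP => k; rewrite mxE [RHS]mxE.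
  have vU : (col k (cokermx G))^T \in U.
    by apply: annih; rewrite trmxK colE mulmxA mulmx_coker mul0mx.
  apply: etrans (hU a _ ah vU).
  by apply: eq_bigr => i _; rewrite !mxE.
split=> [i|].
  rewrite map_mpoly_idfun -[RHS](gu i u ux).
  by apply: meval_eq => k; rewrite join_l.
exists (fun i => l 0 i) => k; rewrite join_r Hl mxE; apply: eq_bigr => i _.
rewrite mxE map_mpoly_idfun; congr (_ * _).
by apply: meval_eq => k'; rewrite join_l.
Qed.

(** Closed sets of pairs are defined by bihomogeneous polynomials only.  But tangent
    pairs are stable under scaling of either factor, so the bihomogeneous parts of a
    polynomial that vanishes on them vanish on them too. *)
Lemma conormal_in_closure (x h : proj K N) u a (p : {mpoly K[N.+1 + N.+1]}) :
  conormal_variety X (x, h) -> u \in line_of x -> a \in line_of h ->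
  (forall z, CK z -> p.@[z] = 0) -> p.@[join (u 0) (a 0)] = 0.
Proof.
move=> cxh ux ah pC.
pose wl (k : 'I_(N.+1 + N.+1)) : nat := if fintype.split k is inl _ then 1%N else 0%N.
pose wr (k : 'I_(N.+1 + N.+1)) : nat := if fintype.split k is inl _ then 0%N else 1%N.
pose part d e := wpart wl d (wpart wr e p).
have scale_l (b : K) z : (fun k => b ^+ wl k * z k) =1
    join (fun i => b * z (lshift _ i)) (fun i => z (rshift _ i)).
  move=> k; rewrite /wl /join -{2}(splitK k); case: (fintype.split k) => i /=.
    by rewrite expr1.
  by rewrite expr0 mul1r.
have scale_r (b : K) z : (fun k => b ^+ wr k * z k) =1
    join (fun i => z (lshift _ i)) (fun i => b * z (rshift _ i)).
  move=> k; rewrite /wr /join -{2}(splitK k); case: (fintype.split k) => i /=.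
    by rewrite expr0 mul1r.
  by rewrite expr1.
have join_ext (v v' t t' : 'I_N.+1 -> K) : v =1 v' -> t =1 t' -> join v t =1 join v' t'.
  by move=> H1 H2 k; rewrite /join; case: (fintype.split k).
have parts v t :
    (forall b c, b != 0 -> c != 0 ->
      p.@[join (fun i => b * v i) (fun i => c * t i)] = 0) ->
    forall d e, (part d e).@[join v t] = 0.
  move=> H d e; apply: (wparts_vanish charK) => b b0.
  rewrite (meval_eq _ (scale_l _ _)); apply: (wparts_vanish charK) => c c0.
  rewrite (meval_eq _ (scale_r _ _)) -[RHS](H b c b0 c0); apply: meval_eq.
  by apply: join_ext => i; rewrite !(join_l, join_r).
have parts_back v t : (forall d e, (part d e).@[join v t] = 0) ->
    forall b c, p.@[join (fun i => b * v i) (fun i => c * t i)] = 0.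
  move=> H b c.
  have H1 e : (wpart wr e p).@[join (fun i => b * v i) t] = 0.
    rewrite -[RHS](wparts_vanish_scale (fun d => H d e) b).
    rewrite (meval_eq _ (scale_l _ _)); apply: meval_eq.
    by apply: join_ext => i; rewrite !(join_l, join_r).
  rewrite -[RHS](wparts_vanish_scale H1 c) (meval_eq _ (scale_r _ _)); apply: meval_eq.
  by apply: join_ext => i; rewrite !(join_l, join_r).
have psupp d e m : m \in msupp (part d e) -> weighted_deg wl m = d /\ weighted_deg wr m = e.
  move=> mp; split; first exact: wpart_homog mp.
  apply: (@wpart_homog _ _ wr e p); move: mp; rewrite 2!mcoeff_msupp.
  by rewrite /part (mcoeff_wpart wl); case: ifP => // _; rewrite eqxx.
have degl m : weighted_deg wl m = (\sum_i m (lshift N.+1 i))%N.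
  rewrite /weighted_deg big_split_ord /= [X in (_ + X)%N]big1 ?addn0.
    by apply: eq_bigr => i _; rewrite /wl -[lshift _ i]/(unsplit (inl i)) unsplitK muln1.
  by move=> i _; rewrite /wl -[rshift _ i]/(unsplit (inr i)) unsplitK muln0.
have degr m : weighted_deg wr m = (\sum_i m (rshift N.+1 i))%N.
  rewrite /weighted_deg big_split_ord /= big1 ?add0n.
    by apply: eq_bigr => i _; rewrite /wr -[rshift _ i]/(unsplit (inr i)) unsplitK muln1.
  by move=> i _; rewrite /wr -[lshift _ i]/(unsplit (inl i)) unsplitK muln0.
pose I : set {mpoly K[N.+1 + N.+1]} := [set q | exists d e, q = part d e].
have Ihom : I `<=` @bihomogeneous K N.
  by move=> _ [d [e ->]]; exists d, e => m /psupp[<- <-]; rewrite degl degr.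
have clC : biproj_closed [set z : proj K N * proj K N | forall q, I q -> bivanishes_at q z].
  by exists I.
have key (z : proj K N * proj K N) v t : line_of z.1 = <[v]>%VS -> line_of z.2 = <[t]>%VS ->
    ((forall q, I q -> bivanishes_at q z) <-> forall d e, (part d e).@[join (v 0) (t 0)] = 0).
  move=> zv zt; split=> [H d e|H _ [d [e ->]] y b].
    have Hq : I (part d e) by exists d, e.
    have := H _ Hq v t; rewrite zv zt !memv_line => /(_ isT isT) <-.
    by apply: meval_eq => k; rewrite row_mx_join.
  rewrite zv zt => /vlineP[c ->] /vlineP[c' ->].
  rewrite (meval_eq _ (row_mx_join _ _)).
  have E : join ((c *: v) 0) ((c' *: t) 0) =1 join (fun i => c * v 0 i) (fun i => c' * t 0 i).
    by apply: join_ext => i; rewrite mxE.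
  rewrite (meval_eq _ E).
  have E2 : join (fun i => c * v 0 i) (fun i => c' * t 0 i) =1
      (fun k => c ^+ wl k * (fun k => c' ^+ wr k * join (v 0) (t 0) k) k).
    pose z' k := c' ^+ wr k * join (v 0) (t 0) k.
    move=> k; apply: (etrans _ (esym (scale_l c z' k))); apply: join_ext => i.
      by rewrite /z' (scale_r c' (join (v 0) (t 0)) (lshift _ i)) !join_l.
    by rewrite /z' (scale_r c' (join (v 0) (t 0)) (rshift _ i)) !join_r.
  rewrite (meval_eq _ E2) (meval_weighted (w := wl) (d := d)); last by move=> m /psupp[].
  rewrite (meval_weighted (w := wr) (d := e)); last by move=> m /psupp[].
  by rewrite H !mulr0.
have [v v0 xv] := proj_generator x; have [t t0 ht] := proj_generator h.
have /(key (x, h) v t xv ht) H :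
    [set z : proj K N * proj K N | forall q, I q -> bivanishes_at q z] (x, h).
  apply: cxh clC _ => -[x' h'] /= [[Xx' _] [U TU hU]].
  have [v' v'0 xv'] := proj_generator x'; have [t' t'0 ht'] := proj_generator h'.
  apply/(key (x', h') v' t' xv' ht'); apply: parts => b c b0 c0.
  have -> : p.@[join (fun i => b * v' 0 i) (fun i => c * t' 0 i)]
      = p.@[join ((b *: v') 0) ((c *: t') 0)].
    by apply: meval_eq; apply: join_ext => i; rewrite mxE.
  apply: pC; apply: (tangent_hyperplane_in_cone Xx' TU hU).
  - by rewrite scaler_eq0 negb_or b0.
  - by rewrite xv' memvZ ?memv_line.
  - by rewrite ht' memvZ ?memv_line.
move: ux ah; rewrite xv ht => /vlineP[b ->] /vlineP[c ->].
rewrite -[RHS](parts_back _ _ H b c); apply: meval_eq.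
by apply: join_ext => i; rewrite mxE.
Qed.

End Conormal.

(** * The dimension bound *)

(** A polynomial over the ultrapower is a family of polynomials over [K].  If these did
    not almost all vanish on the cone, points of the cone at which they are nonzero
    would form a point of the cone over the ultrapower at which [p] is nonzero. *)
Lemma conormal_closure_ultrapower (I : Type) (U : ultra I) (K : fieldType) (n s : nat)
    (g : 'I_s -> {mpoly K[n]}) (w : I -> 'I_(n + n) -> K) :
  ae U (fun i => forall p : {mpoly K[n + n]},
    (forall z, conormal_cone idfun g z -> p.@[z] = 0) -> p.@[w i] = 0) ->
  forall p : {mpoly (upow U K)[n + n]},
    (forall z, conormal_cone (diag U) g z -> p.@[z] = 0) ->
    p.@[fun k => cl U (fun i => w i k)] = 0.
Proof.
move=> Hw p Hp.
pose q i : {mpoly K[n + n]} := \sum_(m <- msupp p) rep p@_m i *: 'X_[m].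
have coefq i m : (q i)@_m = if m \in msupp p then rep p@_m i else 0.
  rewrite /q raddf_sum /=; under eq_bigr => k _ do rewrite mcoeffZ mcoeffX.
  case: ifP => mp; last first.
    rewrite big1_seq // => k /andP[_ kp].
    by case: eqP kp => [->|_ _]; rewrite ?mp ?mulr0.
  rewrite (bigD1_seq m) ?msupp_uniq //= eqxx mulr1 big1 ?addr0 // => k /negPf km.
  by rewrite km mulr0.
have qp (z : 'I_(n + n) -> I -> K) :
    p.@[fun k => cl U (z k)] = cl U (fun i => (q i).@[fun k => z k i]).
  apply: cl_meval => [m|i m].
    have [mp|mp] := boolP (m \in msupp p).
      by rewrite -[RHS]repK; apply/clP/aeT => i; rewrite coefq mp.
    rewrite (memN_msupp_eq0 mp); apply/cl0P/aeT => i.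
    by rewrite coefq (negPf mp).
  by rewrite mcoeff_msupp coefq; case: ifP => //; rewrite eqxx.
rewrite (qp (fun k i => w i k)); apply/cl0P.
have [Hq|Nq] := ae_orC U (fun i => forall z, conormal_cone idfun g z -> (q i).@[z] = 0).
  by apply: ae_mono (ae_and Hw Hq) _ => i [Hi]; exact: Hi.
have [zl Hzl] : exists zl : I -> ('I_(n + n) -> K) * ('I_s -> K), ae U (fun i =>
    [/\ forall j, (g j).@[fun k => (zl i).1 (lshift n k)] = 0,
        forall k, (zl i).1 (rshift n k) =
          \sum_j (zl i).2 j * (g j)^`M(k).@[fun k => (zl i).1 (lshift n k)] &
        (q i).@[(zl i).1] != 0]).
  apply: (@ae_choice _ U _ (fun _ => 0, fun _ => 0) (fun i zl =>
    [/\ forall j, (g j).@[fun k => zl.1 (lshift n k)] = 0,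
        forall k, zl.1 (rshift n k) =
          \sum_j zl.2 j * (g j)^`M(k).@[fun k => zl.1 (lshift n k)] &
        (q i).@[zl.1] != 0])).
  apply: ae_mono Nq _ => i N; apply: contrapT => N'; apply: N => z [gz [l Hl]].
  apply: contrapT => /eqP qz; apply: N'; exists (z, l); split=> //= [j|k].
    by rewrite -[RHS](gz j) map_mpoly_idfun.
  by rewrite Hl; apply: eq_bigr => j _; rewrite map_mpoly_idfun.
pose z k : upow U K := cl U (fun i => (zl i).1 k).
have Cz : conormal_cone (diag U) g z.
  split=> [j|].
    rewrite (diag_meval U _ (fun k i => (zl i).1 (lshift n k))); apply/cl0P.
    by apply: ae_mono Hzl _ => i [].
  exists (fun j => cl U (fun i => (zl i).2 j)) => k.
  under eq_bigr => j _ do rewrite (diag_meval U _ (fun k i => (zl i).1 (lshift n k))) clM.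
  by rewrite cl_sum; apply/clP; apply: ae_mono Hzl _ => i [_ + _].
have := Hp z Cz; rewrite qp => /cl0P q0.
case: (@ae_false _ U); apply: ae_mono (ae_and Hzl q0) _ => i [[_ _ /eqP]].
by [].
Qed.

Lemma spanning_rows (K : fieldType) N (S : set (proj K N)) (U : {vspace 'rV[K]_N.+1}) k :
  is_linear_span S U -> (k <= \dim U)%N ->
  exists A : 'M[K]_(k, N.+1), row_free A /\
    forall i, exists2 x, S x & row i A \in line_of x.
Proof.
move=> [_ minU]; elim: k => [_|k IH kU].
  by exists 0; split=> [|[]//]; rewrite /row_free mxrank0.
have [A [fA HA]] := IH (ltnW kU).
have [u [x Sx ux] uA] : exists2 u, exists2 x, S x & u \in line_of x & ~~ (u <= A)%MS.
  apply: contrapT => N1.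
  pose W := <<[seq row i A | i <- enum 'I_k]>>%VS.
  have UW : (U <= W)%VS.
    apply: minU => x Sx; apply/subvP => u ux.
    have : (u <= A)%MS by apply: contrapT => /negP uA; apply: N1; exists u => //; exists x.
    move=> /submxP[c ->]; rewrite mulmx_sum_row; apply: memv_suml => i _.
    by apply/memvZ/memv_span/map_f; rewrite mem_enum.
  have := leq_trans (dimvS UW) (dim_span _).
  by rewrite size_map size_enum_ord leqNgt kU.
suff [B [fB HB]] : exists B : 'M[K]_(k + 1, N.+1), row_free B /\
    forall i, exists2 x, S x & row i B \in line_of x.
  by move: B fB HB; rewrite addn1 => B; exists B.
exists (col_mx A u); split.
  rewrite -row_leq_rank -addsmxE addn1.
  suff : (\rank A < \rank (A + u)%MS)%N by rewrite (eqP fA).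
  apply: rank_ltmx; rewrite ltmxE addsmxSl; apply: contra uA => H.
  exact: submx_trans (addsmxSr A u) H.
move=> i; rewrite -(splitK i); case: (fintype.split i) => j /=.
  by rewrite rowKu; exact: HA.
by exists x => //; rewrite rowKd (_ : row j u = u) // row_id.
Qed.

Theorem dual_span_locus_dim (K : fieldType) N (X : set (proj K N)) (r : int) :
  alg_closed K -> (forall k, k.+1%:R != 0 :> K) ->
  dim_le (@proj_closed K N) (dual_span_locus X r) (N%:Z - r - 1).
Proof.
move=> cK charK n Z chain.
(* A negative value of r + 1 imposes nothing on the span. *)
pose k : nat := if (r + 1)%R is Posz k then k else 0%N.
suff : (n.+1 + k <= N.+1)%N.
  by rewrite /k; case Em: (r + 1)%R => [m|m]; lia.
have [s [g [gX genX]]] := hilbert_basis (in_ideal X).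
have [j ij] := chain_indep charK cK chain.
have [[C _ EZ] irr] := (proj1 chain) n (leqnn n).
have [U [UC genU]] := generic_exists (irreducible_prime_on charK irr).
pose E := upow U K; pose al : 'I_N.+1 -> E := generic_point U.
have cE : alg_closed E := upow_alg_closed cK.
have charE m : m.+1%:R != 0 :> E by rewrite -(rmorph_nat (diag U)) fmorph_eq0.
have ial : alg_indep (diag U) (al \o j).
  move=> p p0; apply: ij => u Cu; rewrite -meval_rename.
  by move: p0; rewrite -ev_rename => /genU; apply.
have [D HD] := alg_indep_dual_ders cE charE ial.
(* Independence of the tangency points is recorded by a right inverse of the matrix
   of their coordinates, since an equation between matrices passes to ultrapowers. *)
have /choice[AB HAB] : forall u : 'I_N.+1 -> K, exists AB : 'M[K]_(k, N.+1) * 'M[K]_(N.+1, k),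
    cone (Z n) u -> AB.1 *m AB.2 = 1%:M /\ forall i (p : {mpoly K[N.+1 + N.+1]}),
      (forall z, conormal_cone idfun g z -> p.@[z] = 0) -> p.@[join (row i AB.1 0) u] = 0.
  move=> u; have [[h Zh [a ah Ea]]|Nu] := pselect (cone (Z n) u); last by exists (0, 0).
  have : dual_span_locus X r h by move: Zh; rewrite EZ => -[].
  move=> [_ [W spanW rW]]; have kW : (k <= \dim W)%N.
    by rewrite /k; case Em: (r + 1)%R => [m|m]; lia.
  have [A [/row_freeP[B AB1] HA]] := spanning_rows spanW kW.
  exists (A, B) => _; split=> //= i p Hp; have [x Sx xA] := HA i.
  by rewrite Ea; exact: (conormal_in_closure charK gX genX Sx xA ah Hp).
pose A : 'M[E]_(k, N.+1) := \matrix_(i, l) cl U (fun u => (AB u).1 i l).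
pose B : 'M[E]_(N.+1, k) := \matrix_(l, i) cl U (fun u => (AB u).2 l i).
have A_free : row_free A.
  apply/row_freeP; exists B; apply/matrixP => i i'; rewrite !mxE.
  under eq_bigr => l _ do rewrite !mxE clM.
  rewrite cl_sum -(rmorph_nat (diag U)); apply/clP.
  apply: ae_mono UC _ => u /HAB[/matrixP/(_ i i')]; rewrite !mxE.
  by [].
(* The rows of J are tangent vectors of the cone over Z n at its generic point. *)
pose J : 'M[E]_(n.+1, N.+1) := \matrix_(a, l) D a (al l).
have J_free : row_free J.
  apply/row_freeP; exists (\matrix_(l, b) (l == j b)%:R); apply/matrixP => a b.
  rewrite !mxE (bigD1 (j b)) //= !mxE eqxx mulr1 big1 ?addr0.
    by have [_ ->] := HD a.
  by move=> l /negPf lj; rewrite !mxE lj mulr0.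
have JA : J *m A^T = 0.
  apply/matrixP => a i; rewrite [RHS]mxE mxE.
  have [[DD Dc] _] := HD a.
  have ghom i' : exists d : nat, g i' \is d.-homog by have [] := gX i'.
  pose w (u : 'I_N.+1 -> K) := join (row i (AB u).1 0) u.
  have clw := @conormal_closure_ultrapower _ U K _ _ g w
    (ae_mono UC (fun u Cu => proj2 (HAB u Cu) i)).
  apply: (etrans _ (conormal_closure_isotropic cE charE DD Dc ghom clw)).
  apply: eq_bigr => l _; rewrite !mxE mulrC; congr (_ * D a _).
    by apply/clP/aeT => u; rewrite /w join_l mxE.
  by apply/clP/aeT => u; rewrite /w join_r.
have := mulmx0_rank_max JA.
by rewrite mxrank_tr (eqP A_free) (eqP J_free).
Qed.

Theorem theorem1p0p4 (R : realType) (N : nat) (X : set (proj R[i] N))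
    (hX : projective_variety X) (r : int) :
  dim_le (@proj_closed R[i] N) (dual_span_locus X r) (N%:Z - r - 1).
Proof.
apply: dual_span_locus_dim => [p sp|k].
  by apply/closed_rootP; rewrite neq_ltn sp orbT.
by rewrite Num.Theory.pnatr_eq0.
Qed.
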